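(* Let $k\in\mathbf{R}$, $k\neq0$, let $q\in(0,1]$, and let $\alpha_1,\alpha_2,\alpha_3\in\mathbf{R}$ with $\alpha_1\alpha_2\alpha_3\neq0$. Let $\pi:E=\mathbf{R}^3\times\mathbf{R}^3\to\mathbf{R}^3$ be the trivial vector bundle and $\pi^*:E^*=\mathbf{R}^3\times(\mathbf{R}^3)^*\to\mathbf{R}^3$ its dual, with coordinates $(x^1,x^2,x^3,\xi_1,\xi_2,\xi_3)$ on $E^*$. Consider on $E^*$ the linear $2$-tensor field defined by the matrix $\widetilde P$, the left and right fractional anchors $\rho_1,\rho_2$, and the function $H$, where $$\widetilde P=\begin{pmatrix}0&k&-\alpha_3x^2\xi_2\\ -k&0&-\frac{\alpha_2\alpha_3}{\alpha_1}x^1\xi_1\\ \alpha_3x^2\xi_2&\frac{\alpha_2\alpha_3}{\alpha_1}x^1\xi_1&0\end{pmatrix},\qquad \rho_1=\begin{pmatrix}0&k&-\alpha_3x^2\\ -k&0&-\frac{\alpha_2\alpha_3}{\alpha_1}x^1\\ \alpha_3x^2&\frac{\alpha_2\alpha_3}{\alpha_1}x^1&0\end{pmatrix},$$ $$\rho_2=-\begin{pmatrix}0&(x^3)^q&0\\ -(x^3)^q&0&-\frac{\alpha_3}{\alpha_1}(x^1)^q\\ 0&\frac{\alpha_3}{\alpha_1}(x^1)^q&0\end{pmatrix},$$ $$H(x,\xi,k)=\frac{1}{\Gamma(1+q)}\Big[-\alpha_2(x^1)^q(\xi_1)^q+\alpha_1(x^2)^q(\xi_2)^q+\frac{k\alpha_1}{\alpha_3}(\xi_3)^q\Big].$$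 These data form a fractional Leibniz algebroid $(\mathbf{R}^3\times\mathbf{R}^3,\widetilde P,\rho_1,\rho_2)$, and the fractional dynamical system on this fractional Leibniz algebroid associated to $H$ is described by $$\begin{cases} D_t^q\xi_1=k\alpha_1\big((x^2)^q-x^2\xi_2+(\xi_2)^q\big)\\ D_t^q\xi_2=k\alpha_2\big((x^1)^q-x^1\xi_1+(\xi_1)^q\big)\\ D_t^q\xi_3=\alpha_2\alpha_3\big(-(x^1)^qx^2\xi_2+x^1(x^2)^q\xi_1+x^1(\xi_2)^q-x^2(\xi_1)^q\big)\\ D_t^qx^1=\alpha_1(x^2)^q(x^3)^q\\ D_t^qx^2=\alpha_2(x^1)^q(x^3)^q-k(x^1)^q\\ D_t^qx^3=\alpha_3(x^1)^q(x^2)^q . \end{cases}$$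
   Context: Superscripts on $x^1,x^2,x^3$ are coordinate indices; powers are written outside parentheses, e.g. $(x^1)^q$. $\Gamma$ is the Euler Gamma function. Repeated indices are summed. For $0<q<1$ the Caputo derivative of order $q$ is $D_t^qf(t)=\frac{1}{\Gamma(1-q)}\int_0^t(t-s)^{-q}f'(s)\,ds$; for $q=1$, $D_t^1f=df/dt$. $D_{x^i}^q$ and $D_{\xi_u}^q$ are the corresponding Caputo partial derivatives; in particular $D_{x^i}^q(x^i)^m=\frac{\Gamma(1+m)}{\Gamma(1+m-q)}(x^i)^{m-q}$ for the powers $m>0$ considered. Fractional vector fields on a manifold $M$ with local coordinates $x^i$ are locally combinations of the operators $D_{x^i}^q$ with smooth coefficients; $T^qM$ denotes the corresponding fractional tangent bundle. A fractional Leibniz algebroid structure on a vector bundle $\pi:E\to M$ is given by a bracket $[\cdot,\cdot]^q$ on the space of sections $Sec(\pi)$ and two vector bundle morphisms $\rho_1,\rho_2:E\to T^qM$ (the left and right fractional anchors) such that, for a local basis of sections $e_u$, all $\sigma_1,\sigma_2\in Sec(\pi)$ and all $f,g\in C^\infty(M)$, $$[e_u,e_v]^q=C_{uv}^we_w,\qquad [f\sigma_1,g\sigma_2]^q=f\rho_1(\sigma_1)(g)\sigma_2-g\rho_2(\sigma_2)(f)\sigma_1+fg[\sigma_1,\sigma_2]^q .$$ The bundle with this structure is called a fractional Leibniz algebroid. Such structures on $E$ correspond bijectively to linear fractional $2$-tensor fields on the dual bundle $E^*$; with coordinates $(x^i,\xi_u)$ on $E^*$ (and the same order $q$ used in the $x$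 and $\xi$ variables) these have the form $$\Lambda=C_{uv}^w\xi_w\,D_{\xi_u}^q\otimes D_{\xi_v}^q+\rho_{1u}^i\,D_{\xi_u}^q\otimes D_{x^i}^q-\rho_{2u}^i\,D_{x^i}^q\otimes D_{\xi_u}^q .$$ The algebroid is denoted $(E,\widetilde P,\rho_1,\rho_2)$, where $\widetilde P=(C_{uv}^w\xi_w)$, $\rho_1=(\rho_{1u}^i)$, $\rho_2=(\rho_{2u}^i)$. The fractional dynamical system on the fractional Leibniz algebroid associated to $H\in C^\infty(E^* )$ is the system of the vector field $X_H$ with $X_H(F)=\Lambda(d^qF,d^qH)$ for all $F\in C^\infty(E^* )$, where $d^qF=d(x^i)^qD_{x^i}^qF+d(\xi_u)^qD_{\xi_u}^qF$. Locally it reads $D_t^q\xi_u=C_{uv}^w\xi_wD_{\xi_v}^qH+\rho_{1u}^iD_{x^i}^qH$, $D_t^qx^i=-\rho_{2u}^iD_{\xi_u}^qH$, that is, in matrix form for $i,u,v,w=1,2,3$, $$\begin{pmatrix} D_t^q\xi_1 \\ D_t^q\xi_2 \\ D_t^q\xi_3 \end{pmatrix}=\widetilde P\begin{pmatrix} D_{\xi_1}^qH \\ D_{\xi_2}^qH \\ D_{\xi_3}^qH \end{pmatrix}+\rho_1\begin{pmatrix} D_{x^1}^qH \\ D_{x^2}^qH \\ D_{x^3}^qH \end{pmatrix},\qquad \begin{pmatrix} D_t^qx^1 \\ D_t^qx^2 \\ D_t^qx^3 \end{pmatrix}=-\rho_2\begin{pmatrix} D_{\xi_1}^qH \\ D_{\xi_2}^qH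 \\ D_{\xi_3}^qH \end{pmatrix}.$$
   Formalization: As P₁₂=k is not linear in ξ, P may be affine in ξ, its linear part giving the bracket. For q<1 the Leibniz rule, else inconsistent, is asked only for constant-coefficient σ₁,σ₂ (bracket R-bilinear); coordinates and times are positive, and brackets, anchors and X_H smooth only there. *)

(* Defs.v *)
From HB Require Import structures.
From mathcomp Require Import all_boot all_order all_algebra.
From mathcomp Require Import all_classical all_reals all_analysis.
Set Implicit Arguments.
Unset Strict Implicit.
Unset Printing Implicit Defensive.
Import Order.TTheory GRing.Theory Num.Theory.
Import numFieldNormedType.Exports.
Local Open Scope classical_set_scope.
Local Open Scope ring_scope.

Section FractionalCalculus.
Context {R : realType}.

Definition Gamma (s : R) : R :=
  \int[lebesgue_measure]_(t in `]0, +oo[) (t `^ (s - 1) * expR (- t)).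

(* `^ is not the identity on negative reals for exponent 1, whereas for q = 1
   all the data below are meant on the whole of R. *)
Definition fpow (q a : R) : R := if q == 1 then a else a `^ q.

(* The reals at which a function may be raised to the power q and the Caputo
   derivative of order q (based at 0) is taken: all of R for q = 1, the
   positive reals for q < 1. *)
Definition adm (q a : R) : Prop := q = 1 \/ 0 < a.

Definition caputo_kernel (q : R) (f : R -> R) (t s : R) : R :=
  (t - s) `^ (- q) * derive1 f s.

Definition caputo (q : R) (f : R -> R) (t : R) : R :=
  if q == 1 then derive1 f t
  else (Gamma (1 - q))^-1 *
       \int[lebesgue_measure]_(s in `]0, t[) caputo_kernel q f t s.

Definition caputo_derivable (q : R) (f : R -> R) (t : R) : Prop :=
  if q == 1 then derivable f t 1
  else (forall s, 0 < s < t -> derivable f s 1) /\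
       lebesgue_measure.-integrable `]0, t[ (EFin \o caputo_kernel q f t).

Definition is_caputo (q : R) (f : R -> R) (t v : R) : Prop :=
  caputo_derivable q f t /\ caputo q f t = v.

(* On an open set A, existence and continuity on A of all iterated directional
   derivatives of order at most k. *)
Fixpoint Ck (V : normedModType R) (k : nat) (A : set V) (f : V -> R) : Prop :=
  (forall x, A x -> {for x, continuous f}) /\
  if k is k'.+1 then
    forall v : V, (forall x, A x -> derivable f x v) /\
                  Ck k' A (fun x => 'D_v f x)
  else True.

Definition smooth (V : normedModType R) (A : set V) (f : V -> R) : Prop :=
  forall k, Ck k A f.

End FractionalCalculus.

Section Algebroid.
Context {R : realType}.
(* M = R^(n+1) with coordinates x^i; E = M * R^(m+1), and E^* has the
   coordinates (x^i, xi_u). *)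
Variables (n m : nat) (q : R).
Local Notation M := 'rV[R]_n.+1.
Local Notation F := 'rV[R]_m.+1.
Local Notation Es := ('rV[R]_n.+1 * 'rV[R]_m.+1)%type.

Definition adm_vec (d : nat) (x : 'rV[R]_d) : Prop := forall i, adm q (x 0 i).

Definition base_dom : set M := [set x | adm_vec x].
Definition dual_dom : set Es := [set p | adm_vec p.1 /\ adm_vec p.2].

Definition subst_coord (d : nat) (x : 'rV[R]_d) (i : 'I_d) (s : R) : 'rV[R]_d :=
  \row_j (if j == i then s else x 0 j).

(* Caputo partial derivatives on M and on E^*. *)
Definition Dbase (i : 'I_n.+1) (g : M -> R) (x : M) : R :=
  caputo q (fun s => g (subst_coord x i s)) (x 0 i).
Definition Dx (i : 'I_n.+1) (G : Es -> R) (p : Es) : R :=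
  caputo q (fun s => G (subst_coord p.1 i s, p.2)) (p.1 0 i).
Definition Dxi (u : 'I_m.+1) (G : Es -> R) (p : Es) : R :=
  caputo q (fun s => G (p.1, subst_coord p.2 u s)) (p.2 0 u).

(* A section of E is identified with its components in the global basis. *)
Definition is_section (A : set M) (sigma : M -> F) : Prop :=
  forall u, smooth A (fun x => sigma x 0 u).

Definition basis_section (u : 'I_m.+1) : M -> F := fun=> delta_mx 0 u.

(* Entry (u, i) of rho1 is rho_{1u}^i and entry (i, u) of rho2 is rho_{2u}^i:
   these are the positions in which the anchors occur in the matrix form of
   the dynamical system. *)
Definition left_anchor (rho1 : M -> 'M[R]_(m.+1, n.+1)) (sigma : M -> F)
    (g : M -> R) (x : M) : R :=
  \sum_u \sum_i sigma x 0 u * rho1 x u i * Dbase i g x.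
Definition right_anchor (rho2 : M -> 'M[R]_(n.+1, m.+1)) (sigma : M -> F)
    (g : M -> R) (x : M) : R :=
  \sum_u \sum_i sigma x 0 u * rho2 x i u * Dbase i g x.

Definition bilinear_bracket (br : (M -> F) -> (M -> F) -> M -> F) : Prop :=
  forall (a : R) (s1 s2 s : M -> F),
    is_section setT s1 -> is_section setT s2 -> is_section setT s ->
    forall x, base_dom x ->
      br (fun y => a *: s1 y + s2 y) s x = a *: br s1 s x + br s2 s x /\
      br s (fun y => a *: s1 y + s2 y) x = a *: br s s1 x + br s s2 x.

Definition constant_components (sigma : M -> F) : Prop :=
  forall x y, sigma x = sigma y.

(* The rule for [f s1, g s2]. Applying it to [(f1 f2) s1, s2] and to
   [f1 (f2 s1), s2] forces the right anchor to satisfy the ordinary product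
   rule, which Caputo derivatives of order q < 1 do not. Hence for q < 1 it can
   only be imposed for s1, s2 with constant components in the basis e_u;
   together with bilinearity this still determines the whole bracket. For
   q = 1 it is imposed for all sections. *)
Definition leibniz_rule (rho1 : M -> 'M[R]_(m.+1, n.+1))
    (rho2 : M -> 'M[R]_(n.+1, m.+1))
    (br : (M -> F) -> (M -> F) -> M -> F) : Prop :=
  forall (s1 s2 : M -> F) (f g : M -> R),
    is_section setT s1 -> is_section setT s2 ->
    smooth setT f -> smooth setT g ->
    q = 1 \/ (constant_components s1 /\ constant_components s2) ->
    forall x, base_dom x ->
      br (fun y => f y *: s1 y) (fun y => g y *: s2 y) x =
        (f x * left_anchor rho1 s1 g x) *: s2 x
        - (g x * right_anchor rho2 s2 f x) *: s1 x
        + (f x * g x) *: br s1 s2 x.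

(* (E, P, rho1, rho2) is a fractional Leibniz algebroid; C u v x 0 w is
   C_{uv}^w(x). The entries of P are allowed to be affine along the fibres,
   P_{uv} = C_{uv}^w xi_w + c_{uv}, instead of linear (c = 0): a nonzero
   constant entry is never of the form C_{uv}^w xi_w. The linear part gives
   the bracket of the basis sections. For q < 1 the Caputo derivative of a
   smooth function on M need not be smooth up to the coordinate hyperplanes,
   so brackets are sections over base_dom. *)
Definition frac_leibniz_algebroid (P : Es -> 'M[R]_m.+1)
    (rho1 : M -> 'M[R]_(m.+1, n.+1)) (rho2 : M -> 'M[R]_(n.+1, m.+1)) : Prop :=
  [/\ forall u i, smooth base_dom (fun x => rho1 x u i),
      forall i u, smooth base_dom (fun x => rho2 x i u) &
      exists (C : 'I_m.+1 -> 'I_m.+1 -> M -> F) (c : M -> 'M[R]_m.+1)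
             (br : (M -> F) -> (M -> F) -> M -> F),
      [/\ (forall u v, is_section base_dom (C u v)) /\
          (forall u v, smooth base_dom (fun x => c x u v)),
          forall x xi, base_dom x -> forall u v,
            P (x, xi) u v = \sum_w C u v x 0 w * xi 0 w + c x u v,
          forall s1 s2, is_section setT s1 -> is_section setT s2 ->
            is_section base_dom (br s1 s2),
          bilinear_bracket br /\ leibniz_rule rho1 rho2 br &
          forall u v x, base_dom x ->
            br (basis_section u) (basis_section v) x =
              \sum_w C u v x 0 w *: basis_section w x]].

(* d^q G, by its components along d(x^i)^q and d(xi_u)^q. *)
Definition frac_diff (G : Es -> R) (p : Es) : M * F :=
  (\row_i Dx i G p, \row_u Dxi u G p).

(* Lambda = P_{uv} D_{xi_u} (x) D_{xi_v} + rho_{1u}^i D_{xi_u} (x) D_{x^i}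
            - rho_{2u}^i D_{x^i} (x) D_{xi_u}, at p, on two covectors. *)
Definition Lambda (P : Es -> 'M[R]_m.+1) (rho1 : M -> 'M[R]_(m.+1, n.+1))
    (rho2 : M -> 'M[R]_(n.+1, m.+1)) (p : Es) (a b : M * F) : R :=
  \sum_u \sum_v P p u v * a.2 0 u * b.2 0 v
  + \sum_u \sum_i rho1 p.1 u i * a.2 0 u * b.1 0 i
  - \sum_i \sum_u rho2 p.1 i u * a.1 0 i * b.2 0 u.

(* A fractional vector field on E^*, by its components along D_{x^i}^q and
   D_{xi_u}^q. *)
Definition is_frac_vector_field (X : Es -> M * F) : Prop :=
  (forall i, smooth dual_dom (fun p => (X p).1 0 i)) /\
  (forall u, smooth dual_dom (fun p => (X p).2 0 u)).

Definition apply_vf (X : Es -> M * F) (G : Es -> R) (p : Es) : R :=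
  \sum_i (X p).1 0 i * Dx i G p + \sum_u (X p).2 0 u * Dxi u G p.

Definition is_X_H (P : Es -> 'M[R]_m.+1) (rho1 : M -> 'M[R]_(m.+1, n.+1))
    (rho2 : M -> 'M[R]_(n.+1, m.+1)) (H : Es -> R) (X : Es -> M * F) : Prop :=
  is_frac_vector_field X /\
  forall G : Es -> R, smooth setT G -> forall p, dual_dom p ->
    apply_vf X G p = Lambda P rho1 rho2 p (frac_diff G p) (frac_diff H p).

(* The curve (x, xi) satisfies at the times in J the fractional dynamical
   system associated to H. *)
Definition frac_dyn_system (P : Es -> 'M[R]_m.+1)
    (rho1 : M -> 'M[R]_(m.+1, n.+1)) (rho2 : M -> 'M[R]_(n.+1, m.+1))
    (H : Es -> R) (J : set R) (x : R -> M) (xi : R -> F) : Prop :=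
  exists X : Es -> M * F,
    is_X_H P rho1 rho2 H X /\
    forall t, J t ->
      (forall u, is_caputo q (fun s => xi s 0 u) t ((X (x t, xi t)).2 0 u)) /\
      (forall i, is_caputo q (fun s => x s 0 i) t ((X (x t, xi t)).1 0 i)).

End Algebroid.

Section Data.
Context {R : realType}.
Variables (k q alpha1 alpha2 alpha3 : R).
Local Notation Es := ('rV[R]_3 * 'rV[R]_3)%type.

Definition i1 : 'I_3 := @Ordinal 3 0 isT.
Definition i2 : 'I_3 := @Ordinal 3 1 isT.
Definition i3 : 'I_3 := @Ordinal 3 2 isT.

Definition mx3 (rows : seq (seq R)) : 'M[R]_3 :=
  \matrix_(i, j) nth 0 (nth [::] rows i) j.

Definition Ptilde (p : Es) : 'M[R]_3 :=
  let x1 := p.1 0 i1 in let x2 := p.1 0 i2 in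
  let xi1 := p.2 0 i1 in let xi2 := p.2 0 i2 in
  mx3 [:: [:: 0; k; - (alpha3 * x2 * xi2)];
          [:: - k; 0; - (alpha2 * alpha3 / alpha1 * x1 * xi1)];
          [:: alpha3 * x2 * xi2; alpha2 * alpha3 / alpha1 * x1 * xi1; 0]].

Definition rho1 (x : 'rV[R]_3) : 'M[R]_3 :=
  let x1 := x 0 i1 in let x2 := x 0 i2 in
  mx3 [:: [:: 0; k; - (alpha3 * x2)];
          [:: - k; 0; - (alpha2 * alpha3 / alpha1 * x1)];
          [:: alpha3 * x2; alpha2 * alpha3 / alpha1 * x1; 0]].

Definition rho2 (x : 'rV[R]_3) : 'M[R]_3 :=
  let x1 := x 0 i1 in let x3 := x 0 i3 in
  - mx3 [:: [:: 0; fpow q x3; 0];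
            [:: - fpow q x3; 0; - (alpha3 / alpha1 * fpow q x1)];
            [:: 0; alpha3 / alpha1 * fpow q x1; 0]].

Definition Ham (p : Es) : R :=
  let x1 := p.1 0 i1 in let x2 := p.1 0 i2 in
  let xi1 := p.2 0 i1 in let xi2 := p.2 0 i2 in let xi3 := p.2 0 i3 in
  (Gamma (1 + q))^-1 *
  (- alpha2 * fpow q x1 * fpow q xi1 + alpha1 * fpow q x2 * fpow q xi2
   + k * alpha1 / alpha3 * fpow q xi3).

End Data.

(* Main.v *)
Require Import Defs.
From HB Require Import structures.
From mathcomp Require Import all_boot all_order all_algebra.
From mathcomp Require Import all_classical all_reals all_analysis.
From mathcomp Require Import measurable_realfun ring lra.
Import Order.TTheory GRing.Theory Num.Theory.
Import numFieldNormedType.Exports.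
Local Open Scope classical_set_scope.
Local Open Scope ring_scope.
Set Implicit Arguments.
Unset Strict Implicit.
Unset Printing Implicit Defensive.

(** The statement has two halves.

    The algebroid. The Leibniz rule, with bilinearity, leaves one candidate for
    the bracket: expand both sections in the basis [e_u], use the structure
    functions on the basis and the anchors on the coefficients
    ([leibniz_bracket]). Its algebra is immediate, since an anchor is linear
    over functions in the section and satisfies a product rule in the function
    whenever the rule is required ([DbaseM]). The analytic point is that the
    bracket of smooth sections is smooth, that is, that for [q < 1] the Caputo
    partial derivative of a smooth function [g] is smooth where all coordinates
    are positive. Scaling [s = x_i tau] turns it into
    [x_i^(1-q) / Gamma(1-q)] times the integral over [0 < tau < 1] of
    [(1 - tau)^(-q)] against the partial derivative of [g] at the point whose
    [i]-th coordinate has been multiplied by [tau] ([DbaseE]). The domain of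
    integration no longer depends on [x], so this can be differentiated under
    the integral sign: a directional derivative produces two integrals of the
    same shape, one of them with the weight multiplied by [tau - 1], and
    induction on the order applies ([smooth_shrink_wint]). As the shrinking map
    moves the direction too, this uses that the directional derivatives of a
    smooth function depend linearly on the direction ([smooth_derive_linear]).

    The dynamical system. The relation [X_H(F) = Lambda(dF, dH)] is solved by
    contracting [Lambda] with [dH] ([ham_field]), and this determines [X_H] at
    the admissible points, because the coordinate functions are smooth and the
    Caputo derivative of the identity does not vanish there ([is_X_H_unique]). It remains to compute [dH]. In
    each coordinate [s] separately, [H] is affine in [s^q], so everything rests
    on the fact that the Caputo derivative of [s^q] is [Gamma(1 + q)]
    ([caputo_affine_fpow]). For [q < 1] it equals, by scaling,
    [q B(q, 1 - q) / Gamma(1 - q)], and both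
    [B(q, 1 - q) = Gamma(q) Gamma(1 - q)] and [q Gamma(q) = Gamma(1 + q)] are
    cases of
    [Gamma(p) Gamma(p') = B(p, p') Gamma(p + p')] ([eGammaM]), which follows
    from Tonelli's theorem and affine changes of variable. The rest is the
    product of the given matrices with the gradient of [H]. *)

(** * Algebra of smooth functions *)

Section SmoothAlgebra.
Context {R : realType} {V : normedModType R}.
Implicit Types (A : set V) (f g : V -> R) (k : nat).

(** Continuity and directional derivatives at a point only depend on the germ of
    the function there, which the values on an open set determine. *)
Lemma Ck_eq_on k A f g : open A -> (forall x, A x -> f x = g x) ->
  Ck k A f -> Ck k A g.
Proof.
elim: k f g => [|k IH] f g oA fg.
  move=> [cf _]; split => // x Ax.
  change (g y0 @[y0 --> x] --> g x); rewrite -fg //.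
  apply: cvg_trans (cf x Ax); apply: near_eq_cvg; near=> y; apply/fg; near: y.
  exact: open_nbhs_nbhs.
move=> [cf df].
have nfg x : A x -> {near x, f =1 g}.
  move=> Ax; near=> y; apply: fg; near: y; exact: open_nbhs_nbhs.
split.
  move=> x Ax; change (g y0 @[y0 --> x] --> g x); rewrite -fg //.
  by apply: cvg_trans (cf x Ax); apply: near_eq_cvg; exact: nfg.
move=> v; have [dv kv] := df v; split.
  by move=> x Ax; apply: near_eq_derivable (dv x Ax); exact: nfg.
by apply: IH kv => // x Ax; apply: near_eq_derive; exact: nfg.
Unshelve. all: by end_near. Qed.

Lemma Ck_subset k A B f : A `<=` B -> Ck k B f -> Ck k A f.
Proof.
move=> AB; elim: k f => [|k IH] f [cf df]; split => //.
- by move=> x /AB/cf.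
- by move=> x /AB/cf.
- move=> v; have [dv kv] := df v; split; [by move=> x /AB/dv|exact: IH].
Qed.

Lemma CkW k A f : Ck k.+1 A f -> Ck k A f.
Proof.
elim: k f => [|k IH] f [cf df]; split => // v.
have [dv kv] := df v; split => //; exact: IH.
Qed.

Lemma Ck_cst k A (c : R) : Ck k A (fun=> c).
Proof.
elim: k c => [|k IH] c; split => //; try by move=> x _; exact: cvg_cst.
move=> v; split; first by move=> x _; exact: derivable_cst.
have -> : (fun x : V => 'D_v (fun=> c) x) = (fun=> 0 : R).
  by apply/funext => x; exact: derive_cst.
exact: IH.
Qed.

Lemma CkD k A f g : open A -> Ck k A f -> Ck k A g ->
  Ck k A (fun x => f x + g x).
Proof.
move=> oA; elim: k f g => [|k IH] f g [cf df] [cg dg]; split => //;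
  try by move=> x Ax; apply: (@continuousD _ _ _ f g x); [exact: cf|exact: cg].
move=> v; have [df1 kf] := df v; have [dg1 kg] := dg v; split.
  by move=> x Ax; apply: (derivableD (df1 x Ax) (dg1 x Ax)).
apply: (Ck_eq_on oA _ (IH _ _ kf kg)) => x Ax.
exact/esym/(deriveD (df1 x Ax) (dg1 x Ax)).
Qed.

Lemma CkM k A f g : open A -> Ck k A f -> Ck k A g ->
  Ck k A (fun x => f x * g x).
Proof.
move=> oA; elim: k f g => [|k IH] f g kf0 kg0;
  have [cf df] := kf0; have [cg dg] := kg0; split => //;
  try by move=> x Ax; apply: (@continuousM _ _ f g x); [exact: cf|exact: cg].
move=> v; have [df1 kf] := df v; have [dg1 kg] := dg v; split.
  by move=> x Ax; apply: (derivableM (df1 x Ax) (dg1 x Ax)).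
apply: (@Ck_eq_on _ _ (fun x => f x * 'D_v g x + g x * 'D_v f x)) => //.
  by move=> x Ax; exact/esym/(deriveM (df1 x Ax) (dg1 x Ax)).
by apply: CkD => //; apply: IH => //; exact: CkW.
Qed.

Lemma smooth_eq_on A f g : open A -> (forall x, A x -> f x = g x) ->
  smooth A f -> smooth A g.
Proof. by move=> oA fg sf k; exact: (Ck_eq_on oA fg). Qed.

Lemma smooth_subset A B f : A `<=` B -> smooth B f -> smooth A f.
Proof. by move=> AB sf k; exact: (Ck_subset AB). Qed.

Lemma smooth_cst A (c : R) : smooth A (fun=> c).
Proof. by move=> k; exact: Ck_cst. Qed.

Lemma smoothD A f g : open A -> smooth A f -> smooth A g ->
  smooth A (fun x => f x + g x).
Proof. by move=> oA sf sg k; exact: CkD. Qed.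

Lemma smoothM A f g : open A -> smooth A f -> smooth A g ->
  smooth A (fun x => f x * g x).
Proof. by move=> oA sf sg k; exact: CkM. Qed.

Lemma smoothN A f : open A -> smooth A f -> smooth A (fun x => - f x).
Proof.
move=> oA sf; rewrite (_ : (fun x => _) = (fun x => -1 * f x)).
  by apply: smoothM => //; exact: smooth_cst.
by apply/funext => x; rewrite mulN1r.
Qed.

Lemma smoothB A f g : open A -> smooth A f -> smooth A g ->
  smooth A (fun x => f x - g x).
Proof. by move=> oA sf sg; apply: smoothD => //; exact: smoothN. Qed.

Lemma smooth_sum A (I : finType) (F : I -> V -> R) : open A ->
  (forall i, smooth A (F i)) -> smooth A (fun x => \sum_i F i x).
Proof.
move=> oA sF.
elim: (index_enum I) => [|i s IH].
  by under eq_fun do rewrite big_nil; exact: smooth_cst.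
by under eq_fun do rewrite big_cons; exact: smoothD.
Qed.

Lemma smooth_continuous A f x : smooth A f -> A x -> {for x, continuous f}.
Proof. by move=> /(_ 0) [cf _]; exact: cf. Qed.

Lemma smooth_derivable A f v x : smooth A f -> A x -> derivable f x v.
Proof. by move=> /(_ 1) [_ df] Ax; have [+ _] := df v; exact. Qed.

Lemma smooth_derive A f v : smooth A f -> smooth A (fun x => 'D_v f x).
Proof. by move=> sf k; have [_ /(_ v) []] := sf k.+1. Qed.

Lemma smooth_linear A (l : {linear V -> R}) : continuous l -> smooth A l.
Proof.
move=> cl; case=> [|k]; (split; first by move=> x _; exact: cl); first by [].
move=> v.
have lE x : is_derive x v l (l v).
  have dl : differentiable l x by exact: linear_differentiable.
  split; first exact: diff_derivable.
  by rewrite deriveE // diff_lin.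
split; first by move=> x _; exact: ex_derive.
have -> : (fun x : V => 'D_v l x) = (fun=> l v).
  by apply/funext => x; exact: derive_val.
exact: Ck_cst.
Qed.

(** Restricting [f] to the line [h |-> h *: v + x] turns the directional
    derivative into an ordinary one, and the one-variable chain rule applies. *)
Lemma is_derive_comp_dir (f : V -> R) (g : R -> R) (x v : V) (df dg : R) :
  is_derive x v f df -> is_derive (f x) 1 g dg ->
  is_derive x v (g \o f) (dg * df).
Proof.
move=> [df1 df2] [dg1 dg2].
pose p (h : R) := f (h *: v + x).
have p0 : p 0 = f x by rewrite /p scale0r add0r.
have dp : derivable p 0 1 by exact: (derivable1P f x v).1.
have along (u : V -> R) : 'D_v u x = 'D_1 (fun h : R => u (h *: v + x)) 0.
  rewrite /derive; set g1 := fun h => h^-1 *: _; set g2 := fun h => h^-1 *: _.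
  suff -> : g1 = g2 by [].
  apply/funext => h; rewrite /g1 /g2 /=.
  by rewrite addr0 scale0r add0r [_%:A]mulr1.
have dgp : derivable g (p 0) 1 by rewrite p0; exact: dg1.
split.
  apply: (derivable1P (g \o f) x v).2; apply: (derivable1_diffP _ _).2.
  apply: (@differentiable_comp _ _ _ _ p g).
    exact: (derivable1_diffP _ _).1 dp.
  exact: (derivable1_diffP _ _).1 dgp.
rewrite along -derive1E (derive1_comp dp dgp).
by rewrite !derive1E p0 dg2 -(along f) df2.
Qed.

(** Differentiating lowers the exponent by one and brings out smooth factors, so
    the induction on the order has to treat all exponents at once. *)
Lemma smooth_powR A f (a : R) : open A -> smooth A f ->
  (forall x, A x -> 0 < f x) -> smooth A (fun x => f x `^ a).
Proof.
move=> oA sf f0 k.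
have dE b v x : A x ->
    is_derive x v (fun y => f y `^ b) (b * f x `^ (b - 1) * 'D_v f x).
  move=> Ax.
  have df : is_derive x v f ('D_v f x).
    by apply: derivableP; exact: smooth_derivable Ax.
  exact: (is_derive_comp_dir df (is_derive1_powR b (f0 _ Ax))).
have cE b x : A x -> {for x, continuous (fun y => f y `^ b)}.
  move=> Ax.
  have cp : {for f x, continuous (fun y : R => y `^ b)}.
    apply/differentiable_continuous/derivable1_diffP.
    exact: (@ex_derive _ _ _ _ _ _ _ (is_derive1_powR b (f0 _ Ax))).
  exact: (continuous_comp (smooth_continuous sf Ax) cp).
elim: k a => [|k IH] a; split => //; try exact: cE.
move=> v; split.
  by move=> x Ax; have := dE a v x Ax => ?; exact: ex_derive.
apply: (@Ck_eq_on _ _ (fun x => a * f x `^ (a - 1) * 'D_v f x)) => //.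
  by move=> x Ax; have := dE a v x Ax => ?; rewrite derive_val.
apply: CkM => //; last exact: smooth_derive.
by apply: CkM => //; exact: Ck_cst.
Qed.

Lemma is_derive_line f (y w : V) (s : R) : derivable f (s *: w + y) w ->
  is_derive s 1 (fun t : R => f (t *: w + y)) ('D_w f (s *: w + y)).
Proof.
move=> df.
have E : (fun h : R => h^-1 *: (((fun t : R => f (t *: w + y)) \o shift s)
             (h *: 1) - f (s *: w + y))) =
         (fun h : R => h^-1 *: ((f \o shift (s *: w + y)) (h *: w)
             - f (s *: w + y))).
  by apply/funext => h /=; rewrite [h%:A]mulr1 scalerDl addrA.
by split; rewrite /derivable /derive E.
Qed.

(** For a negative [r], the one-variable mean value theorem is applied from the
    other end point. *)
Lemma mean_value_line f (y w : V) (r : R) : (forall x, derivable f x w) ->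
  exists2 s, `|s| <= `|r| & f (r *: w + y) - f y = r * 'D_w f (s *: w + y).
Proof.
move=> df.
have pos (z : V) (a : R) : 0 < a ->
    exists2 s, 0 <= s <= a & f (a *: w + z) - f z = a * 'D_w f (s *: w + z).
  move=> a0.
  have [||s] := @MVT R (fun t => f (t *: w + z))
      (fun t => 'D_w f (t *: w + z)) 0 a a0.
  - by move=> t _; exact: is_derive_line.
  - apply: derivable_within_continuous => t _.
    exact: (@ex_derive _ _ _ _ _ _ _ (is_derive_line (df _))).
  rewrite in_itv/= scale0r add0r subr0 => /andP[s0 sa] ->.
  by exists s; rewrite ?(ltW s0) ?(ltW sa)// mulrC.
have [r0|r0|->] := ltgtP r 0; last first.
- by exists 0 => //; rewrite !scale0r add0r subrr mul0r.
- have [s /andP[s0 sr] ->] := pos y r r0.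
  by exists s => //; rewrite !ger0_norm // ltW.
- have nr0 : 0 < - r by rewrite oppr_gt0.
  have [s /andP[s0 sr]] := pos (r *: w + y) _ nr0.
  rewrite addrA -scalerDl addNr scale0r add0r addrA -scalerDl mulNr => E.
  exists (s + r); last by apply: oppr_inj; rewrite opprB.
  by rewrite (ltr0_norm r0) ler0_norm; lra.
Qed.

Lemma derive_cvg f (x v : V) : derivable f x v ->
  (fun h : R => h^-1 * (f (h *: v + x) - f x)) @ 0^' --> 'D_v f x.
Proof. by []. Qed.

(** The increment along [v + c *: w] splits into an increment along [v] and one
    along [w]; the mean value theorem turns the latter into a value of the
    derivative along [w] near [x], where it is continuous. *)
Lemma derive_direction_linear f (v w : V) (c : R) (x : V) :
  derivable f x v -> (forall y, derivable f y w) ->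
  {for x, continuous (fun y => 'D_w f y)} ->
  'D_(v + c *: w) f x = 'D_v f x + c * 'D_w f x.
Proof.
move=> dv dw cw; apply: cvg_lim => //=.
rewrite (_ : (fun h => _) = fun h : R => h^-1 * (f (h *: v + x) - f x)
   + h^-1 * (f ((h * c) *: w + (h *: v + x)) - f (h *: v + x))); last first.
  apply/funext => h; rewrite -mulrDr [X in _ = _ * X]addrC subrKA.
  congr (_ * (f _ - _)).
  by rewrite scalerDr scalerA addrA [_ *: w + _]addrC.
apply: cvgD; first exact: derive_cvg.
apply/cvgrPdist_le => e e0.
have c1 : 0 < `|c| + 1 by rewrite ltr_wpDl.
have /cvgrPdist_le/(_ (e / (`|c| + 1)) (divr_gt0 e0 c1)) := cw.
rewrite -nbhs_nearE => /nbhs_ballP[d /= d0 dP].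
pose K := `|v| + `|c| * `|w| + 1.
have K0 : 0 < K by rewrite ltr_wpDl // addr_ge0 // mulr_ge0.
near=> h.
have h0 : h != 0 by near: h; exact: nbhs_dnbhs_neq.
have hd : `|h| < d / K.
  near: h; apply: dnbhs0_lt; exact: divr_gt0.
have [s sr ->] := mean_value_line (h *: v + x) (h * c) dw.
rewrite mulrA mulrA mulVf // mul1r -mulrBr normrM.
have /dP /= : ball x d (s *: w + (h *: v + x)).
  rewrite -ball_normE /ball_ /= addrA opprD addrCA subrr addr0 normrN.
  apply: le_lt_trans (ler_normD _ _) _; rewrite !normrZ.
  move: hd; rewrite ltr_pdivlMr //; apply: le_lt_trans.
  rewrite /K !mulrDr mulr1 addrC mulrA -addrA lerD2l.
  by rewrite ler_wpDr // ler_wpM2r // -normrM.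
move=> H; apply: (@le_trans _ _ ((`|c| + 1) * (e / (`|c| + 1)))).
  by apply: ler_pM => //; rewrite ler_wpDr.
by rewrite mulrC divfK // gt_eqF.
Unshelve. all: by end_near. Qed.

Lemma smooth_derive_linear f (v w : V) (c : R) (x : V) : smooth setT f ->
  'D_(v + c *: w) f x = 'D_v f x + c * 'D_w f x.
Proof.
move=> sf; apply: derive_direction_linear => [|y|].
- exact: smooth_derivable sf _.
- exact: smooth_derivable sf _.
- by apply: smooth_continuous (smooth_derive w sf) _.
Qed.

End SmoothAlgebra.

(** * The Gamma and Beta integrals *)

Section GammaBeta.
Context {R : realType}.
Local Notation mu := (@lebesgue_measure R).

Definition affine (c d : R) : measurableTypeR R -> measurableTypeR R :=
  fun x => c * x + d.

Lemma measurable_affine c d : measurable_fun setT (affine c d).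
Proof. by apply: measurable_funD => //; exact: measurable_funM. Qed.

(** Lebesgue measure is the only measure giving intervals their length, and [c]
    times its image under [x |-> c * x + d] is such a measure. *)
Lemma ge0_integral_affine (c d : R) (f : R -> \bar R) : 0 < c ->
  measurable_fun setT f -> (forall x, 0 <= f x)%E ->
  (\int[mu]_x f x = c%:E * \int[mu]_x f (c * x + d)%R)%E.
Proof.
move=> c0 mf f0.
pose nu : {measure set (measurableTypeR R) -> \bar R} :=
  measure_function_pushforward__canonical__measure_function_Measure
    mu (measurable_affine c d).
rewrite (@eq_measure_integral _ _ _ _ (mscale (NngNum (ltW c0)) nu)).
  rewrite ge0_integral_mscale //=; congr (_ * _)%E.
  by rewrite ge0_integral_pushforward //; exact: measurable_affine.
move=> A mA _; apply: lebesgue_measure_unique => //= _ [[a b]] _ <-.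
rewrite /mscale /= /pushforward.
have -> : affine c d @^-1` `]a, b] = `](a - d) / c, (b - d) / c]%classic.
  apply/seteqP; split => x /=; rewrite !in_itv/= /affine ltr_pdivrMr // ler_pdivlMr //
    ltrBlDr lerBrDr mulrC //.
rewrite !lebesgue_measure_itv/= !lte_fin ltr_pM2r ?invr_gt0 // ltrD2r.
case: ifPn => ab; last by rewrite mule0.
by rewrite -!EFinD -EFinM; congr EFin; field; rewrite gt_eqF.
Qed.

(** The power is extended by [0] to the negative half-line so that the Gamma and
    Beta integrals below range over the whole line, where translations and
    scalings do not affect the domain of integration. *)
Definition pospow (s x : R) : R := if 0 < x then x `^ s else 0.

Lemma pospow_ge0 s x : 0 <= pospow s x.
Proof. by rewrite /pospow; case: ifP => // _; exact: powR_ge0. Qed.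

Lemma pospowM s r x : 0 < r -> pospow s (r * x) = r `^ s * pospow s x.
Proof.
move=> r0; rewrite /pospow pmulr_rgt0 //; case: ifPn => x0; last by rewrite mulr0.
by rewrite powRM // ltW.
Qed.

Lemma measurable_pospow s : measurable_fun [set: R] (pospow s).
Proof.
by apply: measurable_fun_ifT => //; exact: measurable_fun_ltr.
Qed.

(** Both integrals are kept as extended reals, so that Tonelli's theorem gives the
    product formula first and convergence can then be read off from it. *)
Definition eGamma (p : R) : \bar R :=
  (\int[mu]_x (pospow (p - 1) x * expR (- x))%:E)%E.

Definition eBeta (p p' : R) : \bar R :=
  (\int[mu]_x (pospow (p - 1) x * pospow (p' - 1) (1 - x))%:E)%E.

Local Open Scope ereal_scope.

Let measurable_gammaI p :
  measurable_fun [set: R] (fun x => (pospow (p - 1) x * expR (- x))%:E).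
Proof.
apply/measurable_EFinP/measurable_funM; first exact: measurable_pospow.
exact: (measurableT_comp (@measurable_expR R) (@oppr_measurable R setT)).
Qed.

Let measurable_betaI p p' :
  measurable_fun [set: R]
    (fun x => (pospow (p - 1) x * pospow (p' - 1) (1 - x))%:E).
Proof.
apply/measurable_EFinP/measurable_funM; first exact: measurable_pospow.
apply: (measurableT_comp (measurable_pospow _)).
exact: measurable_funB.
Qed.

Lemma eGamma_ge0 p : 0 <= eGamma p.
Proof.
by apply: integral_ge0 => x _; rewrite lee_fin mulr_ge0 ?pospow_ge0 ?expR_ge0.
Qed.

Lemma eBeta_ge0 p p' : 0 <= eBeta p p'.
Proof.
by apply: integral_ge0 => x _; rewrite lee_fin mulr_ge0 ?pospow_ge0.
Qed.

(** Write the product as a double integral over [(a, b)], translate [b = r - a],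
    exchange the integrals by Tonelli's theorem, and scale [a = r t]. *)
Lemma eGammaM p p' : eGamma p * eGamma p' = eBeta p p' * eGamma (p + p').
Proof.
pose F (a r : R) : R :=
  (pospow (p - 1) a * pospow (p' - 1) (r - a) * expR (- r))%R.
have F0 a r : (0 <= F a r)%R by rewrite !mulr_ge0 ?pospow_ge0 ?expR_ge0.
have mF : measurable_fun [set: R * R] (fun z => (F z.1 z.2)%:E).
  apply/measurable_EFinP/measurable_funM; first apply: measurable_funM.
  - exact: (measurableT_comp (measurable_pospow _) measurable_fst).
  - apply: (measurableT_comp (measurable_pospow _)).
    exact: measurable_funB.
  - exact: (measurableT_comp (measurableT_comp (@measurable_expR R)
      (@oppr_measurable R setT)) measurable_snd).
transitivity (\int[mu]_a \int[mu]_r (F a r)%:E).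
  rewrite [eGamma p]/eGamma -ge0_integralZr //; last first.
  - exact: eGamma_ge0.
  - by move=> x _; rewrite lee_fin mulr_ge0 ?pospow_ge0 ?expR_ge0.
  - exact: measurable_gammaI.
  apply: eq_integral => a _.
  rewrite /eGamma (@ge0_integral_affine 1 (- a)) //; last first.
    by move=> x; rewrite lee_fin mulr_ge0 ?pospow_ge0 ?expR_ge0.
  rewrite mul1e -ge0_integralZl //; last first.
  - by rewrite lee_fin mulr_ge0 ?pospow_ge0 ?expR_ge0.
  - by move=> x _; rewrite lee_fin mulr_ge0 ?pospow_ge0 ?expR_ge0.
  - have := measurableT_comp (measurable_gammaI p') (measurable_affine 1 (- a)%R).
    exact.
  apply: eq_integral => r _; rewrite -EFinM mul1r /F; congr EFin.
  by rewrite mulrACA -expRD; congr (_ * expR _)%R; ring.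
transitivity (\int[mu]_r \int[mu]_a (F a r)%:E).
  apply: (@fubini_tonelli _ _ (measurableTypeR R) (measurableTypeR R) R mu mu
    (fun z => (F z.1 z.2)%:E)) => //.
  by move=> z; rewrite lee_fin.
rewrite [eGamma (p + p')]/eGamma -ge0_integralZl //; last first.
- exact: eBeta_ge0.
- by move=> x _; rewrite lee_fin mulr_ge0 ?pospow_ge0 ?expR_ge0.
- exact: measurable_gammaI.
apply: eq_integral => r _.
have mFr : measurable_fun [set: R] (fun a => (F a r)%:E).
  exact: (measurableT_comp mF (pair2_measurable r)).
have [r0|r0] := ltP 0%R r; last first.
  rewrite {1}/pospow ltNge r0 /= mul0r mule0 integral0_eq // => a _.
  rewrite /F /pospow; case: ifPn => a0; last by rewrite !mul0r.
  rewrite subr_gt0 ifF ?mulr0 ?mul0r //; apply/negbTE.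
  by rewrite -leNgt (le_trans r0) ?ltW.
rewrite (@ge0_integral_affine r 0) //; last by move=> x; rewrite lee_fin.
transitivity (r%:E * \int[mu]_x ((r `^ (p - 1) * r `^ (p' - 1) * expR (- r))%:E
    * (pospow (p - 1) x * pospow (p' - 1) (1 - x))%:E)).
  congr (_ * _); apply: eq_integral => x _; rewrite -EFinM addr0 /F.
  rewrite (_ : r - r * x = r * (1 - x))%R; last by ring.
  by rewrite !pospowM //; congr EFin; ring.
rewrite ge0_integralZl //; last first.
- by rewrite lee_fin !mulr_ge0 ?powR_ge0 ?expR_ge0.
- by move=> x _; rewrite lee_fin mulr_ge0 ?pospow_ge0.
- exact: measurable_betaI.
rewrite muleA -EFinM muleC; congr (_ * EFin _).
rewrite /pospow r0 !mulrA; congr (_ * _)%R.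
rewrite -[X in (X * _ * _)%R](powRr1 (ltW r0)) -!powRD ?(gt_eqF r0) ?implybT //.
by congr (_ `^ _)%R; ring.
Qed.

Lemma integral_powR_itvcc (q a b : R) : (0 < q)%R -> (0 < a)%R -> (a < b)%R ->
  \int[mu]_(x in `[a, b]) (x `^ (q - 1))%:E =
    (b `^ q / q)%:E - (a `^ q / q)%:E.
Proof.
move=> q0 a0 ab.
have dF (x : R) : (0%R < x)%R ->
    is_derive x 1%R (fun y => y `^ q / q)%R (x `^ (q - 1))%R.
  move=> x0; have := is_derive1_powR q x0 => dq.
  have := is_deriveM dq (@is_derive_cst R R R (q^-1)%R x 1%R).
  rewrite scaler0 add0r /= => /is_derive_eq; apply.
  by rewrite /cst [_ *: _]mulrA mulVf ?mul1r ?gt_eqF.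
have cF (x : R) : (0 < x)%R -> {for x, continuous (fun y => y `^ q / q)%R}.
  move=> x0; apply/differentiable_continuous/derivable1_diffP.
  exact: (@ex_derive _ _ _ _ _ _ _ (dF _ x0)).
apply: (@continuous_FTC2 _ _ (fun y => y `^ q / q)%R) => //.
- apply: derivable_within_continuous => x.
  rewrite in_itv/= => /andP[ax _].
  exact: (@ex_derive _ _ _ _ _ _ _ (is_derive1_powR _ (lt_le_trans a0 ax))).
- split.
  + move=> x; rewrite in_itv/= => /andP[ax _].
    exact: (@ex_derive _ _ _ _ _ _ _ (dF _ (lt_trans a0 ax))).
  + exact/cvg_at_right_filter/cF.
  + exact/cvg_at_left_filter/cF/(lt_trans a0).
- move=> x; rewrite in_itv/= => /andP[ax _]; rewrite derive1E.
  exact: (@derive_val _ _ _ _ _ _ _ (dF _ (lt_trans a0 ax))).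
Qed.

Lemma cvg_powR_inv_nat (q : R) : (0 < q)%R ->
  ((n.+2%:R^-1 : R) `^ q)%R @[n --> \oo] --> (0 : R)%R.
Proof.
move=> q0; have /cvg_at_rightP := powR_cvg0 q0; apply; split => //.
by have := @cvg_harmonic R; rewrite -cvg_shiftS.
Qed.

(** The integrand is unbounded at [0]: exhaust the interval by the segments from
    [1 / (n + 2)] to [1], nondegenerate already for [n = 0]. *)
Lemma eBeta1 (q : R) : (0 < q)%R -> eBeta q 1 = (q^-1)%:E.
Proof.
move=> q0; pose F (n : nat) : set R := `[(n.+2%:R^-1)%R, 1%R]%classic.
have F01 n : (0 < n.+2%:R^-1 :> R)%R by rewrite invr_gt0 ltr0n.
have UF : \bigcup_n F n = `]0%R, 1%R]%classic.
  apply/seteqP; split => x.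
    move=> [n _]; rewrite /F /= !in_itv/= => /andP[nx x1].
    by rewrite x1 andbT (lt_le_trans _ nx).
  rewrite /= in_itv/= => /andP[x0 x1].
  have [n _ /(_ n (leqnn _)) /= nx] := near_infty_natSinv_lt (PosNum x0).
  exists n => //; rewrite /F /= in_itv/= x1 andbT.
  apply: le_trans (ltW nx); rewrite lef_pV2 ?posrE ?ltr0n // ler_nat //.
have mf (A : set R) : measurable_fun A (fun x => (x `^ (q - 1))%:E).
  by apply/measurable_EFinP; apply: measurable_funTS; exact: measurable_powR.
have : \int[mu]_(x in F n) (x `^ (q - 1))%:E @[n --> \oo] -->
       \int[mu]_(x in \bigcup_n F n) (x `^ (q - 1))%:E.
  apply: ge0_nondecreasing_set_cvg_integral => //.
  - move=> m n mn; rewrite subsetEset => x; rewrite /F /= !in_itv/=.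
    move=> /andP[mx ->]; rewrite andbT; apply: le_trans mx.
    by rewrite lef_pV2 ?posrE ?ltr0n // ler_nat.
  - by move=> n; exact: measurable_itv.
  - by move=> n; exact: mf.
  - by move=> n x _; rewrite lee_fin powR_ge0.
move=> /cvg_lim => /(_ (@ereal_hausdorff R)) E.
have -> : eBeta q 1 = \int[mu]_(x in \bigcup_n F n) (x `^ (q - 1))%:E.
  rewrite UF /eBeta -integral_itv_bndo_bndc // [RHS]integral_mkcond.
  apply: eq_integral => x _; rewrite patchE /pospow subrr powRr0 subr_gt0.
  case: ifPn => x0; case: ifPn => x1; rewrite ?mulr1 ?mulr0 ?mul0r.
  - by rewrite mem_set //= in_itv/= x0 x1.
  - by rewrite memNset //= in_itv/= (negbTE x1) andbF.
  - by rewrite memNset //= in_itv/= (negbTE x0).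
  - by rewrite memNset //= in_itv/= (negbTE x0).
rewrite -E; apply/cvg_lim => //.
rewrite (_ : (fun n => _) =
    (fun n => (q^-1 - (n.+2%:R^-1 : R) `^ q * q^-1)%R%:E)).
  apply: cvg_EFin; first exact: nearW.
  rewrite -[X in _ --> X]subr0 -(mul0r (q^-1)%R).
  apply: cvgB; first exact: cvg_cst.
  apply: cvgM; [exact: cvg_powR_inv_nat|exact: cvg_cst].
apply/funext => n; rewrite integral_powR_itvcc // ?powR1 ?mul1r //.
by rewrite invf_lt1 ?ltr0n // ltr1n.
Qed.

Lemma eGamma1 : eGamma 1 = 1.
Proof.
rewrite -(integral_exponential_pdf (@ltr01 R)).
have -> : eGamma 1 = \int[mu]_(x in `]0%R, +oo[) (expR (- x))%:E.
  rewrite [RHS]integral_mkcond; apply: eq_integral => x _.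
  rewrite patchE /pospow subrr powRr0; case: ifPn => x0.
    by rewrite mem_set ?mul1r //= in_itv/= x0.
  by rewrite memNset ?mul0r //= in_itv/= (negbTE x0).
rewrite integral_itv_obnd_cbnd; last first.
  apply/measurable_EFinP/measurable_funTS.
  exact: (measurableT_comp (@measurable_expR R) (@oppr_measurable R setT)).
rewrite integral_mkcond; apply: eq_integral => x _.
rewrite /exponential_pdf !patchE; case: ifP => // _.
by rewrite mul1r mulN1r.
Qed.

(** This comparison and the next make Gamma positive and finite on [0 < p <= 1],
    so that it can be cancelled in the product formula. *)
Lemma eBeta1_le_eGamma (p : R) : (expR (-1))%:E * eBeta p 1 <= eGamma p.
Proof.
rewrite /eBeta -ge0_integralZl //; last first.
- by move=> x _; rewrite lee_fin mulr_ge0 ?pospow_ge0.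
- exact: measurable_betaI.
apply: ge0_le_integral => //.
- by move=> x _; rewrite -EFinM lee_fin !mulr_ge0 ?pospow_ge0 ?expR_ge0.
- apply/measurable_EFinP/measurable_funM => //.
  by apply/measurable_EFinP; exact: measurable_betaI.
- exact: measurable_gammaI.
move=> x _; rewrite -EFinM lee_fin mulrCA; apply: ler_wpM2l.
  exact: pospow_ge0.
rewrite subrr /pospow powRr0 subr_gt0; case: ifPn => x1;
  rewrite ?mulr1 ?mulr0 ?expR_ge0//.
by rewrite ler_expR lerN2 ltW.
Qed.

Lemma eGamma_le_eBeta1 (p : R) : (p <= 1)%R -> eGamma p <= eBeta p 1 + 1.
Proof.
move=> p1; rewrite -eGamma1 /eBeta [eGamma 1]/eGamma -ge0_integralD //; last first.
- exact: measurable_gammaI.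
- by move=> x _; rewrite lee_fin mulr_ge0 ?pospow_ge0 ?expR_ge0.
- exact: measurable_betaI.
- by move=> x _; rewrite lee_fin mulr_ge0 ?pospow_ge0.
apply: ge0_le_integral => //.
- by move=> x _; rewrite lee_fin mulr_ge0 ?pospow_ge0 ?expR_ge0.
- exact: measurable_gammaI.
- by apply: emeasurable_funD; [exact: measurable_betaI|exact: measurable_gammaI].
move=> x _; rewrite -EFinD lee_fin subrr /pospow !powRr0.
case: ifPn => x0; last by rewrite !mul0r addr0.
rewrite subr_gt0 mul1r; case: ifPn => x1; rewrite ?mulr1 ?mulr0 ?add0r.
  rewrite ler_wpDr ?expR_ge0 // ler_piMr ?powR_ge0 //.
  by rewrite -[leRHS]expR0 ler_expR oppr_le0 ltW.
rewrite -leNgt in x1; rewrite ler_piMl ?expR_ge0 //.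
have p10 : (p - 1 <= 0)%R by rewrite subr_le0.
by have := ler_powR x1 p10; rewrite powRr0.
Qed.

Local Close Scope ereal_scope.

Lemma GammaE p : Gamma p = fine (eGamma p) :> R.
Proof.
rewrite /Gamma /Rintegral /eGamma; congr fine.
rewrite integral_mkcond; apply: eq_integral => x _.
rewrite patchE /pospow; case: (ltP 0 x) => x0.
  by rewrite mem_set //= in_itv/= x0.
by rewrite memNset ?mul0r //= in_itv/= ltNge x0.
Qed.

Lemma eGammaE (p : R) : 0 < p <= 1 -> eGamma p = (Gamma p)%:E /\ 0 < Gamma p.
Proof.
move=> /andP[p0 p1].
have := eBeta1_le_eGamma p; have := eGamma_le_eBeta1 p1.
rewrite eBeta1 // GammaE; case: (eGamma p) => [r| |] //=.
rewrite -EFinM -EFinD !lee_fin => _ pr; split => //.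
by apply: lt_le_trans pr; rewrite mulr_gt0 ?expR_gt0 ?invr_gt0.
Qed.

(** The case [p' = 1] of the product formula. *)
Lemma eGammaS (q : R) : 0 < q <= 1 -> eGamma (1 + q) = (q * Gamma q)%:E.
Proof.
move=> q01; have [E _] := eGammaE q01; have /andP[q0 _] := q01.
have := eGammaM q 1; rewrite eGamma1 eBeta1 // E mule1 addrC => /esym EM.
rewrite EFinM -EM muleA -EFinM mulfV ?mul1e // gt_eqF//.
Qed.

Lemma GammaS (q : R) : 0 < q <= 1 -> Gamma (1 + q) = q * Gamma q.
Proof. by move=> q01; rewrite GammaE eGammaS. Qed.

Lemma Gamma1 : Gamma 1 = 1 :> R.
Proof. by rewrite GammaE eGamma1. Qed.

Lemma Gamma_gt0 (p : R) : 0 < p <= 1 -> 0 < Gamma p.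
Proof. by move=> /eGammaE []. Qed.

Lemma GammaS_gt0 (q : R) : 0 < q <= 1 -> 0 < Gamma (1 + q).
Proof.
by move=> q01; have /andP[q0 _] := q01; rewrite GammaS // mulr_gt0 // Gamma_gt0.
Qed.

(** The case [p + p' = 1] of the product formula. *)
Lemma eBeta_compl (q : R) : 0 < q < 1 ->
  eBeta q (1 - q) = (Gamma q * Gamma (1 - q))%:E.
Proof.
move=> /andP[q0 q1].
have q01 : 0 < q <= 1 by rewrite q0 ltW.
have p01 : 0 < 1 - q <= 1 by lra.
have := eGammaM q (1 - q); rewrite addrCA subrr addr0 eGamma1 mule1 => <-.
by rewrite EFinM -(eGammaE q01).1 -(eGammaE p01).1.
Qed.

(** The left-hand side of the product formula is symmetric, hence so is the Beta
    integral once the finite positive factor [Gamma (1 + q)] is cancelled. *)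
Lemma eBeta_1 (q : R) : 0 < q <= 1 -> eBeta 1 q = (q^-1)%:E.
Proof.
move=> q01; have /andP[q0 _] := q01.
have := eGammaM 1 q; rewrite muleC eGammaM addrC eGammaS // eBeta1 // => /esym.
have G0 : 0 < q * Gamma q by rewrite mulr_gt0 // Gamma_gt0.
case: (eBeta 1 q) => [r| |].
- by rewrite -!EFinM => -[/mulIf ->] //; rewrite gt_eqF.
- by rewrite gt0_mulye ?lte_fin.
- by rewrite gt0_mulNye ?lte_fin.
Qed.

End GammaBeta.

(** * Caputo derivatives of powers *)

Section CaputoScale.
Context {R : realType}.
Local Notation mu := (@lebesgue_measure R).

(** When [x] and [y] are both infinite, both sides are the conventional value
    [-oo] of [+oo - +oo]. *)
Let muleBr_pos (c : R) (x y : \bar R) : 0 < c -> (0 <= x)%E -> (0 <= y)%E ->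
  (c%:E * (x - y) = c%:E * x - c%:E * y)%E.
Proof.
move=> c0; case: x => [x| |] //; case: y => [y| |] // _ _.
- by rewrite -EFinB -!EFinM mulrBr.
- by rewrite addeNy -EFinM gt0_muley ?lte_fin // gt0_muleNy ?lte_fin.
- by rewrite -EFinM gt0_muley ?lte_fin.
- by rewrite addeNy gt0_muley ?lte_fin // gt0_muleNy ?lte_fin.
Qed.

Lemma integral_affine (c d : R) (f : R -> \bar R) : 0 < c ->
  measurable_fun setT f ->
  (\int[mu]_x f x = c%:E * \int[mu]_x f (c * x + d)%R)%E.
Proof.
move=> c0 mf; rewrite integralE [in RHS]integralE.
rewrite muleBr_pos //; last 2 first.
- exact: integral_ge0.
- exact: integral_ge0.
rewrite (ge0_integral_affine d c0 (measurable_funepos mf)) //.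
rewrite (ge0_integral_affine d c0 (measurable_funeneg mf)) //.
by congr (_ * _ - _ * _)%E; apply: eq_integral => x _;
  rewrite ?funeposE ?funenegE.
Qed.

Definition caputo_weight (q tau : R) : R := (1 - tau) `^ (- q).

Lemma eBetaE (p p' : R) :
  (\int[mu]_(x in `]0%R, 1%R[) (x `^ (p - 1) * (1 - x) `^ (p' - 1))%:E =
    eBeta p p')%E.
Proof.
rewrite integral_mkcond; apply: eq_integral => x _; rewrite patchE /pospow subr_gt0.
case: (ltP 0 x) => x0; case: (ltP x 1) => x1.
- by rewrite mem_set //= in_itv/= x0.
- by rewrite memNset ?mulr0 //= in_itv/= [x < 1]ltNge x1 andbF.
- by rewrite memNset ?mul0r //= in_itv/= [0 < x]ltNge x0.
- by rewrite memNset ?mul0r //= in_itv/= [0 < x]ltNge x0.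
Qed.

Lemma integrable_beta (p p' b : R) : eBeta p p' = b%:E ->
  mu.-integrable `]0, 1[ (fun x : R => (x `^ (p - 1) * (1 - x) `^ (p' - 1))%:E).
Proof.
move=> E; apply/integrableP; split.
  apply/measurable_EFinP/measurable_funTS/measurable_funM.
    exact: measurable_powR.
  apply: (measurableT_comp (@measurable_powR R (p' - 1))).
  exact: measurable_funB.
suff -> : (\int[mu]_(x in `]0%R, 1%R[)
    `|(x `^ (p - 1) * (1 - x) `^ (p' - 1))%:E| = eBeta p p')%E by rewrite E ltry.
rewrite -eBetaE; apply: eq_integral => x _.
by rewrite /= ger0_norm // mulr_ge0 // powR_ge0.
Qed.

Lemma caputo_weightE (q x : R) :
  caputo_weight q x = x `^ (1 - 1) * (1 - x) `^ (1 - q - 1).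
Proof. by rewrite subrr powRr0 mul1r /caputo_weight; congr (_ `^ _); ring. Qed.

Lemma integrable_caputo_weight (q : R) : 0 < q < 1 ->
  mu.-integrable `]0, 1[ (fun tau => (caputo_weight q tau)%:E).
Proof.
move=> q01; have E : eBeta 1 (1 - q) = ((1 - q)^-1)%:E by apply: eBeta_1; lra.
have -> : (fun tau => (caputo_weight q tau)%:E) = (fun x : R =>
    (x `^ (1 - 1) * (1 - x) `^ (1 - q - 1))%:E).
  by apply/funext => x; rewrite caputo_weightE.
exact: integrable_beta E.
Qed.

Lemma integral_caputo_weight (q : R) : 0 < q < 1 ->
  \int[mu]_(tau in `]0, 1[) caputo_weight q tau = (1 - q)^-1.
Proof.
move=> q01; have E : eBeta 1 (1 - q) = ((1 - q)^-1)%:E by apply: eBeta_1; lra.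
rewrite /Rintegral; under eq_integral do rewrite caputo_weightE.
by rewrite eBetaE E.
Qed.

(** The substitution [s = t tau] frees the domain of integration and the kernel
    from the point [t]. *)
Lemma caputo_scale (q t : R) (f phi : R -> R) : q != 1 -> 0 < t ->
  (forall s, 0 < s < t -> derive1 f s = phi s) ->
  measurable_fun (`]0, t[ : set R) phi ->
  mu.-integrable `]0, 1[ (fun tau => (caputo_weight q tau * phi (t * tau))%:E) ->
  caputo q f t = (Gamma (1 - q))^-1 * (t `^ (1 - q) *
    \int[mu]_(tau in `]0, 1[) (caputo_weight q tau * phi (t * tau))).
Proof.
move=> q1 t0 fphi mphi iphi; rewrite /caputo (negbTE q1); congr (_ * _).
rewrite /Rintegral.
have -> : (\int[mu]_(s in `]0%R, t[) (caputo_kernel q f t s)%:E =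
    (t `^ (1 - q))%:E *
    \int[mu]_(tau in `]0%R, 1%R[) (caputo_weight q tau * phi (t * tau))%:E)%E.
  transitivity (\int[mu]_(s in `]0%R, t[) ((t - s) `^ (- q) * phi s)%:E)%E.
    apply: eq_integral => s; rewrite inE/= in_itv/= => s0t.
    by rewrite /caputo_kernel fphi.
  rewrite integral_mkcond (integral_affine 0 t0); last first.
    apply/(measurable_restrictT _ _).1 => //.
    apply/measurable_EFinP/measurable_funM => //.
    apply: measurable_funTS; apply: (measurableT_comp (@measurable_powR R (- q))).
    exact: measurable_funB.
  have -> : (\int[mu]_x ((fun s => ((t - s) `^ (- q) * phi s)%:E) \_ `]0%R, t[)
       (t * x + 0)%R = \int[mu]_(x in `]0%R, 1%R[) ((t `^ (- q))%:E *
         (caputo_weight q x * phi (t * x))%:E))%E.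
    rewrite [RHS]integral_mkcond; apply: eq_integral => x _.
    rewrite !patchE addr0.
    have -> : (t * x \in `]0, t[%classic) = (x \in `]0, 1[%classic).
      by apply/idP/idP; rewrite !inE/= !in_itv/= pmulr_rgt0 // gtr_pMr.
    case: ifPn => //; rewrite inE/= in_itv/= => /andP[x0 x1].
    rewrite -EFinM mulrA /caputo_weight -powRM ?(ltW t0) ?subr_ge0 ?(ltW x1) //.
    by rewrite mulrBr mulr1.
  rewrite integralZl // muleA -EFinM; congr (EFin _ * _)%E.
  rewrite -[X in X * _](powRr1 (ltW t0)) -powRD //.
  by rewrite (gt_eqF t0) implybT.
rewrite fineM //; exact: integrable_fin_num.
Qed.

Lemma caputo_cst (q c t : R) : caputo q (fun=> c) t = 0.
Proof.
rewrite /caputo /Rintegral derive1_cst; case: ifP => // _.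
rewrite integral0_eq /= ?mulr0 // => s _.
by rewrite /caputo_kernel derive1_cst mulr0.
Qed.

(** This is what lets the coordinate functions detect the components of a
    fractional vector field. *)
Lemma caputo_id_neq0 (q t : R) : 0 < q <= 1 -> adm q t -> caputo q id t != 0.
Proof.
move=> /andP[q0 q1] adm; have [->|qn1] := eqVneq q 1.
  by rewrite /caputo eqxx derive1E derive_id oner_neq0.
have t0 : 0 < t by case: adm => // /eqP; rewrite (negbTE qn1).
have q01 : 0 < q < 1 by rewrite q0 lt_neqAle qn1.
rewrite (@caputo_scale q t id (fun=> 1)) //; last 2 first.
- by move=> s _; rewrite derive1E derive_id.
- apply: eq_integrable (integrable_caputo_weight q01) => // x _.
  by rewrite /= mulr1.
under eq_Rintegral do rewrite mulr1.
rewrite integral_caputo_weight // !mulf_neq0 ?invr_eq0 // ?gt_eqF ?powR_gt0 //.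
- by apply: Gamma_gt0; lra.
- lra.
Qed.

(** The derivative of the function is [a q s^(q - 1)], so that scaling leaves
    [a q B(q, 1 - q)]: the powers of [t] cancel. *)
Lemma caputo_affine_fpow (q a b t : R) : 0 < q <= 1 -> adm q t ->
  caputo q (fun s => a * fpow q s + b) t = a * Gamma (1 + q).
Proof.
move=> q01 adm; rewrite GammaS //; have /andP[q0 q1] := q01.
have [->|qn1] := eqVneq q 1.
  rewrite /caputo eqxx Gamma1 !mulr1 derive1E /fpow eqxx.
  rewrite deriveD // deriveM // derive_id !derive_cst scaler0 !addr0.
  by rewrite [_ *: _]mulr1.
have t0 : 0 < t by case: adm => // /eqP; rewrite (negbTE qn1).
have q01' : 0 < q < 1 by rewrite q0 lt_neqAle qn1.
have Gp : 0 < Gamma (1 - q) :> R by apply: Gamma_gt0; lra.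
have E := eBeta_compl q01'.
pose phi s : R := a * q * s `^ (q - 1).
have phiE tau : 0 < tau -> caputo_weight q tau * phi (t * tau) =
    a * q * t `^ (q - 1) * (tau `^ (q - 1) * (1 - tau) `^ (1 - q - 1)).
  move=> tau0; rewrite /phi powRM ?(ltW t0) ?(ltW tau0) // /caputo_weight.
  by rewrite (_ : 1 - q - 1 = - q); [ring|ring].
have ib : mu.-integrable `]0, 1[ (fun tau : R => (a * q * t `^ (q - 1) *
    (tau `^ (q - 1) * (1 - tau) `^ (1 - q - 1)))%:E).
  have := @integrableZl _ _ _ mu _ _ (a * q * t `^ (q - 1)) _ (integrable_beta E).
  by move=> /(_ (measurable_itv _)); apply: eq_integrable => // x _; rewrite EFinM.
rewrite (@caputo_scale q t _ phi) //; last 3 first.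
- move=> s /andP[s0 _]; rewrite derive1E /fpow (negbTE qn1).
  have da := is_deriveM (@is_derive_cst R R R a s 1) (is_derive1_powR q s0).
  have := is_deriveD da (@is_derive_cst R R R b s 1).
  move=> /(@derive_val _ _ _ _ _ _ _) ->.
  by rewrite scaler0 !addr0 /phi -mulrA.
- apply: measurable_funTS; apply: measurable_funM => //; exact: measurable_powR.
- apply: eq_integrable ib => // x; rewrite inE/= in_itv/= => /andP[x0 _].
  by rewrite phiE.
have -> : \int[mu]_(tau in `]0, 1[) (caputo_weight q tau * phi (t * tau)) =
    \int[mu]_(tau in `]0, 1[) (a * q * t `^ (q - 1) *
      (tau `^ (q - 1) * (1 - tau) `^ (1 - q - 1))).
  apply: eq_Rintegral => x; rewrite inE/= in_itv/= => /andP[x0 _].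
  by rewrite phiE.
rewrite RintegralZl //; last exact: (integrable_beta E).
rewrite {1}/Rintegral eBetaE E /=.
have : t `^ (1 - q) * t `^ (q - 1) = 1.
  by rewrite -powRD ?(gt_eqF t0) ?implybT // addrC subrKA subrr powRr0.
have : Gamma (1 - q) != 0 :> R by rewrite gt_eqF.
move: (Gamma (1 - q)) (Gamma q) (t `^ (1 - q)) (t `^ (q - 1)) => G G' T T' G0 TT.
rewrite (_ : _ * _ = (G^-1 * G) * (T * T') * (a * q * G')); last by ring.
by rewrite TT mulVf // !mul1r mulrA.
Qed.

End CaputoScale.

(** * Smoothness of weighted integrals *)

Section WeightedIntegral.
Context {R : realType}.
Local Notation mu := (@lebesgue_measure R).
Implicit Types (w phi psi u : R -> R).

Definition weight w := mu.-integrable `]0, 1[ (EFin \o w).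

Definition wint w phi : R := \int[mu]_(tau in `]0, 1[) (w tau * phi tau).

Lemma bounded01 phi : continuous phi -> [bounded phi x | x in (`]0, 1[ : set R)].
Proof.
move=> cphi.
have : bounded_set (phi @` `[0, 1]).
  apply/compact_bounded/continuous_compact; last exact: segment_compact.
  exact: continuous_subspaceT.
move=> [M [Mr HM]]; exists M; split => // y My x /= x01.
apply: (HM y My); exists x => //.
by move: x01; rewrite /= !in_itv/= => /andP[/ltW -> /ltW ->].
Qed.

Lemma weightM w u : weight w -> continuous u -> weight (fun tau => w tau * u tau).
Proof.
move=> iw cu; have := @integrableMl _ _ _ mu _ (measurable_itv _) _ u iw.
apply; last exact: bounded01.
by apply: measurable_funTS; exact: continuous_measurable_fun.
Qed.

Lemma wintD w phi psi : weight w -> continuous phi -> continuous psi ->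
  wint w (fun tau => phi tau + psi tau) = wint w phi + wint w psi.
Proof.
move=> iw cphi cpsi; rewrite /wint -RintegralD //; try exact: weightM.
by apply: eq_Rintegral => x _; rewrite mulrDr.
Qed.

Lemma wintZ w phi (c : R) : weight w -> continuous phi ->
  wint w (fun tau => c * phi tau) = c * wint w phi.
Proof.
move=> iw cphi; rewrite /wint -RintegralZl //; last exact: weightM.
by apply: eq_Rintegral => x _; rewrite mulrCA.
Qed.

Lemma wintB w phi psi : weight w -> continuous phi -> continuous psi ->
  wint w (fun tau => phi tau - psi tau) = wint w phi - wint w psi.
Proof.
move=> iw cphi cpsi; rewrite /wint -RintegralB //; try exact: weightM.
by apply: eq_Rintegral => x _; rewrite mulrBr.
Qed.

Definition wnorm w : R := \int[mu]_(tau in `]0, 1[) `|w tau|.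

Lemma wnorm_ge0 w : 0 <= wnorm w.
Proof. exact: Rintegral_ge0. Qed.

Lemma wint_le w phi (c : R) : weight w -> continuous phi ->
  (forall tau, 0 <= tau <= 1 -> `|phi tau| <= c) -> `|wint w phi| <= c * wnorm w.
Proof.
move=> iw cphi bphi.
have iwphi := weightM iw cphi.
have iaw : mu.-integrable `]0, 1[ (EFin \o (fun tau => `|w tau|)).
  by have := integrable_abse iw; apply: eq_integrable.
apply: le_trans (le_normr_Rintegral _ iwphi) _ => //.
rewrite /wnorm -RintegralZl //; apply: le_Rintegral => //.
- by have := integrable_abse iwphi; apply: eq_integrable.
- have := @integrableZl _ _ _ mu _ (measurable_itv _) c _ iaw.
  by apply: eq_integrable.
- move=> x; rewrite /= in_itv/= => /andP[x0 x1].
  by rewrite normrM mulrC ler_wpM2r // bphi // !ltW.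
Qed.

End WeightedIntegral.

Section ParametricIntegral.
Context {R : realType} {V : normedModType R}.
Variables (l : {linear V -> R}) (cl : continuous l) (e : V).
Implicit Types (w : R -> R) (h : V -> R).

(** When [l] is a coordinate and [e] the corresponding basis vector, this map
    multiplies that coordinate by [tau] and fixes the others. *)
Definition shrink (tau : R) (x : V) : V := x + ((tau - 1) * l x) *: e.

Lemma shrinkDZ tau (s : R) (v x : V) :
  shrink tau (s *: v + x) = s *: shrink tau v + shrink tau x.
Proof.
rewrite /shrink (_ : _ * l _ = s * ((tau - 1) * l v) + (tau - 1) * l x).
  by rewrite scalerDl -scalerA scalerDr addrACA.
by rewrite linearD linearZ /= [_ *: _]mulrC; ring.
Qed.

Lemma continuous_shrink : continuous (fun z : R * V => shrink z.1 z.2).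
Proof.
move=> z; apply: cvgD; first exact: cvg_snd.
apply: cvgZr_tmp; apply: cvgM.
  by apply: cvgB; [exact: cvg_fst|exact: cvg_cst].
by apply: (cvg_comp _ _ (@cvg_snd _ _ _ _ _)); exact: cl.
Qed.

Lemma continuous_shrinkl x : continuous (shrink ^~ x).
Proof.
move=> tau; apply: cvgD; first exact: cvg_cst.
apply: cvgZr_tmp; apply: cvgM; last exact: cvg_cst.
by apply: cvgB; [exact: cvg_id|exact: cvg_cst].
Qed.

Lemma continuous_comp_shrinkl h x : continuous h ->
  continuous (fun tau => h (shrink tau x)).
Proof.
move=> ch tau; apply: (@continuous_comp _ _ _ (shrink ^~ x) h).
  exact: continuous_shrinkl.
exact: ch.
Qed.

(** Joint continuity in [(tau, y)] and compactness of the segment of the [tau]. *)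
Lemma shrink_uniform h x (eps : R) : continuous h -> 0 < eps ->
  \forall y \near x, forall tau : R, 0 <= tau <= 1 ->
    `|h (shrink tau y) - h (shrink tau x)| <= eps.
Proof.
move=> ch eps0.
have /compact_near_coveringP/(_ V (nbhs x)
   (fun y tau => `|h (shrink tau y) - h (shrink tau x)| <= eps)) :=
   @segment_compact R 0 1.
have H : forall tau : R, `[0, 1]%classic tau ->
    \forall tau' \near tau & y \near x,
      `|h (shrink tau' y) - h (shrink tau' x)| <= eps.
  move=> tau _.
  have e2 : 0 < eps / 2 by rewrite divr_gt0.
  have c1 : h (shrink z.1 z.2) @[z --> (tau, x)] --> h (shrink tau x).
    exact: (cvg_comp _ _ (@continuous_shrink (tau, x)) (ch _)).
  have c2 : h (shrink z.1 x) @[z --> (tau, x)] --> h (shrink tau x).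
    apply: (cvg_comp (fun z : R * V => z.1) (fun t => h (shrink t x))).
      exact: cvg_fst.
    exact: continuous_comp_shrinkl.
  move/cvgrPdist_le : c1 => /(_ _ e2) c1.
  move/cvgrPdist_le : c2 => /(_ _ e2) c2.
  near=> z; rewrite [eps]splitr.
  rewrite -(subrKA (h (shrink tau x))).
  apply: le_trans (ler_normD _ _) _; apply: lerD; last first.
    by near: z.
  rewrite distrC.
  by near: z.
move=> /(_ _ H); apply: filterS => y Py tau t01; apply: Py.
by rewrite /= in_itv.
Unshelve. all: by end_near. Qed.

Definition shrink_wint w h (x : V) : R := wint w (fun tau => h (shrink tau x)).

Lemma continuous_shrink_wint w h :
  weight w -> continuous h -> continuous (shrink_wint w h).
Proof.
move=> iw ch x; apply/cvgrPdist_le => eps eps0.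
have N1 : 0 < wnorm w + 1 by rewrite ltr_wpDl // wnorm_ge0.
have := shrink_uniform x ch (divr_gt0 eps0 N1); apply: filterS => y Hy.
rewrite /shrink_wint -wintB //; try exact: continuous_comp_shrinkl.
apply: le_trans (@wint_le _ w _ (eps / (wnorm w + 1)) iw _ _) _.
- by move=> tau; apply: continuousB; exact: continuous_comp_shrinkl.
- by move=> tau t01; rewrite distrC; exact: Hy.
- by rewrite mulrAC ler_pdivrMr // ler_wpM2l ?(ltW eps0) // lerDl.
Qed.

Lemma near_segment (v x : V) (P : V -> Prop) : (\forall y \near x, P y) ->
  \forall s \near (0 : R), forall a, `|a| <= `|s| -> P (a *: v + x).
Proof.
rewrite -nbhs_nearE => /nbhs_ballP[d /= d0 dP].
have v1 : 0 < `|v| + 1 by rewrite ltr_wpDl.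
have dv0 : 0 < d / (`|v| + 1) by exact: divr_gt0.
near=> s.
have sd : `|s| < d / (`|v| + 1) by near: s; exact: (@nbhs0_lt R R^o).
move=> a as_; apply: dP.
rewrite -ball_normE /ball_ /= opprD addrCA subrr addr0 normrN normrZ.
move: sd; rewrite ltr_pdivlMr //; apply: le_lt_trans.
by apply: ler_pM => //; rewrite lerDl.
Unshelve. all: by end_near. Qed.

(** The difference quotient at [tau] is, by the mean value theorem, a derivative of
    [h] at a nearby point along the shrunk direction [v + (tau - 1) l(v) e]. It
    splits linearly into derivatives along [v] and [e], which are close to their
    values at [x] uniformly in [tau]. *)
Lemma is_derive_shrink_wint w h (v x : V) : weight w -> smooth setT h ->
  is_derive x v (shrink_wint w h)
    (shrink_wint w (fun y => 'D_v h y) x +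
     l v * shrink_wint (fun tau => w tau * (tau - 1)) (fun y => 'D_e h y) x).
Proof.
move=> iw sh.
have cont (f : V -> R) : smooth setT f -> continuous f.
  by move=> sf y; exact: smooth_continuous sf _.
have ch := cont _ sh.
have cv := cont _ (smooth_derive v sh).
have ce := cont _ (smooth_derive e sh).
have shc y := @continuous_comp_shrinkl h y ch.
have sv y := @continuous_comp_shrinkl _ y cv.
have se y := @continuous_comp_shrinkl _ y ce.
pose theta (y : V) (tau : R) : R := 'D_v h (shrink tau y) +
  (tau - 1) * l v * 'D_e h (shrink tau y).
have csub : continuous (fun tau : R => tau - 1).
  by move=> tau; apply: cvgB; [exact: cvg_id|exact: cvg_cst].
have ctheta y : continuous (theta y).
  move=> tau; apply: cvgD; first exact: sv.
  apply: cvgM; last exact: se.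
  by apply: cvgM; [exact: csub|exact: cvg_cst].
have -> : shrink_wint w (fun y => 'D_v h y) x +
    l v * shrink_wint (fun tau => w tau * (tau - 1)) (fun y => 'D_e h y) x =
    wint w (theta x).
  rewrite /theta wintD //; last first.
    move=> tau; apply: cvgM; last exact: se.
    by apply: cvgM; [exact: csub|exact: cvg_cst].
  congr (_ + _).
  rewrite -wintZ //; last exact: weightM.
  by apply: eq_Rintegral => tau _; ring.
have lim : (fun s : R =>
    s^-1 * (shrink_wint w h (s *: v + x) - shrink_wint w h x)) @ 0^' -->
    wint w (theta x).
  apply/cvgrPdist_le => eps eps0.
  have N1 : 0 < wnorm w + 1 by rewrite ltr_wpDl // wnorm_ge0.
  have L1 : 0 < `|l v| + 1 by rewrite ltr_wpDl.
  (* [theta] is a combination of two derivatives with coefficients at most [1]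
     and [`|l v|]; integration then costs a factor [wnorm w]. *)
  pose d := eps / (wnorm w + 1) / (`|l v| + 1).
  have d0 : 0 < d by rewrite !divr_gt0.
  have := near_segment v (shrink_uniform x cv d0).
  have := near_segment v (shrink_uniform x ce d0).
  move=> nHe nHv; near=> s.
  have s0 : s != 0 by near: s; exact: nbhs_dnbhs_neq.
  have He : forall a, `|a| <= `|s| -> forall tau : R, 0 <= tau <= 1 ->
    `|'D_e h (shrink tau (a *: v + x)) - 'D_e h (shrink tau x)| <= d.
    by near: s; move: nHe; exact: nbhs_dnbhs.
  have Hv : forall a, `|a| <= `|s| -> forall tau : R, 0 <= tau <= 1 ->
    `|'D_v h (shrink tau (a *: v + x)) - 'D_v h (shrink tau x)| <= d.
    by near: s; move: nHv; exact: nbhs_dnbhs.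
  rewrite /shrink_wint -wintB //; try exact: shc.
  rewrite -wintZ //; last first.
    by move=> tau; apply: cvgB; exact: shc.
  rewrite -wintB //; last first.
    move=> tau; apply: cvgM; first exact: cvg_cst.
    by apply: cvgB; exact: shc.
  apply: le_trans (@wint_le _ w _ (eps / (wnorm w + 1)) iw _ _) _.
  - move=> tau; apply: cvgB; first exact: ctheta.
    apply: cvgM; first exact: cvg_cst.
    by apply: cvgB; exact: shc.
  - move=> tau t01; rewrite shrinkDZ.
    have [a as_ ->] := mean_value_line (shrink tau x) s
      (fun y => @smooth_derivable _ _ setT h (shrink tau v) y sh I).
    rewrite mulrA mulVf // mul1r -shrinkDZ.
    rewrite [X in 'D_X _ _](_ : _ = v + ((tau - 1) * l v) *: e) //.
    rewrite smooth_derive_linear // /theta opprD addrACA -mulrBr.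
    have -> : eps / (wnorm w + 1) = d + `|l v| * d.
      by rewrite /d; field; rewrite !gt_eqF.
    apply: le_trans (ler_normD _ _) _; apply: lerD.
      by rewrite distrC; exact: Hv.
    rewrite normrM distrC; apply: ler_pM => //; last exact: He.
    rewrite normrM ler_piMl // ler_norml; lra.
  - by rewrite mulrAC ler_pdivrMr // ler_wpM2l ?(ltW eps0) // lerDl.
split; first by apply/cvg_ex; exists (wint w (theta x)).
exact: cvg_lim lim.
Unshelve. all: by end_near. Qed.

(** The factor [tau - 1] in the derivative is absorbed by the weight, so the
    induction on the order has to treat all weights at once. *)
Lemma smooth_shrink_wint w h :
  weight w -> smooth setT h -> smooth setT (shrink_wint w h).
Proof.
move=> iw sh k; elim: k w h iw sh => [|k IH] w h iw sh.
  split => // x _; apply: continuous_shrink_wint => // y.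
  exact: smooth_continuous sh _.
split.
  move=> x _; apply: continuous_shrink_wint => // y.
  exact: smooth_continuous sh _.
move=> v; split.
  move=> x _.
  exact: (@ex_derive _ _ _ _ _ _ _ (is_derive_shrink_wint v x iw sh)).
apply: (@Ck_eq_on _ _ k setT (fun x => shrink_wint w (fun y => 'D_v h y) x +
     l v * shrink_wint (fun tau => w tau * (tau - 1)) (fun y => 'D_e h y) x)).
- exact: openT.
- move=> x _; apply/esym.
  exact: (@derive_val _ _ _ _ _ _ _ (is_derive_shrink_wint v x iw sh)).
- apply: CkD; [exact: openT| |].
    by apply: IH => //; exact: smooth_derive.
  apply: CkM; [exact: openT|exact: Ck_cst|].
  apply: IH; last exact: smooth_derive.
  apply: weightM => // tau.
  by apply: cvgB; [exact: cvg_id|exact: cvg_cst].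
Qed.

End ParametricIntegral.

(** * Caputo partial derivatives *)

Section Domains.
Context {R : realType}.

Lemma open_adm (q : R) : open [set a : R | adm q a].
Proof.
have [q1|q1] := eqVneq q 1.
  rewrite (_ : [set a | _] = setT); first exact: openT.
  by apply/seteqP; split => // x _; left.
rewrite (_ : [set a | _] = [set a | 0 < a]); first exact: open_gt.
by apply/seteqP; split => x /=; [case=> // /eqP; rewrite (negbTE q1)|right].
Qed.

Lemma open_adm_vec (q : R) (T : topologicalType) d (f : T -> 'rV[R]_d) :
  (forall i, continuous (fun x => f x 0 i)) -> open [set x | adm_vec q (f x)].
Proof.
move=> cf; rewrite openE => x /= fx; rewrite /interior.
have : \forall y \near x, forall i : 'I_d, adm q (f y 0 i).
  apply: filter_forall => i.
  have : nbhs (f x 0 i) [set a | adm q a].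
    by apply: open_nbhs_nbhs; split; [exact: open_adm|exact: fx].
  by move=> /(cf i x); apply: filterS.
by apply: filterS => y Hy i; exact: Hy.
Qed.

Lemma open_base_dom (n : nat) (q : R) : open (@base_dom R n q).
Proof. by apply: (@open_adm_vec q _ _ id) => i; exact: coord_continuous. Qed.

Lemma continuous_coord1 n m i :
  continuous (fun p : 'rV[R]_n.+1 * 'rV[R]_m.+1 => p.1 0 i).
Proof.
move=> p; apply: (@continuous_comp _ _ _ fst (fun x : 'rV[R]_n.+1 => x 0 i)).
  exact: cvg_fst.
exact: coord_continuous.
Qed.

Lemma continuous_coord2 n m i :
  continuous (fun p : 'rV[R]_n.+1 * 'rV[R]_m.+1 => p.2 0 i).
Proof.
move=> p; apply: (@continuous_comp _ _ _ snd (fun x : 'rV[R]_m.+1 => x 0 i)).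
  exact: cvg_snd.
exact: coord_continuous.
Qed.

Lemma open_dual_dom (n m : nat) (q : R) : open (@dual_dom R n m q).
Proof.
rewrite (_ : @dual_dom R n m q =
  [set p | adm_vec q p.1] `&` [set p | adm_vec q p.2]) //.
apply: openI; apply: open_adm_vec => i.
- exact: continuous_coord1.
- exact: continuous_coord2.
Qed.

Section Coordinates.
Variables (n m : nat).

Definition row_coord (i : 'I_n.+1) (x : 'rV[R]_n.+1) : R := x 0 i.
Fact row_coord_is_linear i : linear (row_coord i).
Proof. by move=> a x y; rewrite /row_coord !mxE. Qed.
HB.instance Definition _ i :=
  GRing.isLinear.Build R 'rV[R]_n.+1 R _ (row_coord i) (row_coord_is_linear i).

Definition coord1 i (p : 'rV[R]_n.+1 * 'rV[R]_m.+1) : R := p.1 0 i.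
Fact coord1_is_linear i : linear (coord1 i).
Proof. by move=> a x y; rewrite /coord1 !mxE. Qed.
HB.instance Definition _ i :=
  GRing.isLinear.Build R ('rV[R]_n.+1 * 'rV[R]_m.+1)%type R _ (coord1 i)
    (coord1_is_linear i).

Definition coord2 i (p : 'rV[R]_n.+1 * 'rV[R]_m.+1) : R := p.2 0 i.
Fact coord2_is_linear i : linear (coord2 i).
Proof. by move=> a x y; rewrite /coord2 !mxE. Qed.
HB.instance Definition _ i :=
  GRing.isLinear.Build R ('rV[R]_n.+1 * 'rV[R]_m.+1)%type R _ (coord2 i)
    (coord2_is_linear i).

Lemma smooth_coord A i : smooth A (fun x : 'rV[R]_n.+1 => x 0 i).
Proof.
exact: (@smooth_linear _ _ A (row_coord i) (@coord_continuous _ _ _ _ _)).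
Qed.

Lemma smooth_coord1 A i :
  smooth A (fun p : 'rV[R]_n.+1 * 'rV[R]_m.+1 => p.1 0 i).
Proof. exact: (@smooth_linear _ _ A (coord1 i) (@continuous_coord1 _ _ _)). Qed.

Lemma smooth_coord2 A i :
  smooth A (fun p : 'rV[R]_n.+1 * 'rV[R]_m.+1 => p.2 0 i).
Proof. exact: (@smooth_linear _ _ A (coord2 i) (@continuous_coord2 _ _ _)). Qed.

End Coordinates.

Lemma smooth_fpow (V : normedModType R) (A : set V) (q : R) (f : V -> R) :
  open A -> smooth A f -> (forall x, A x -> adm q (f x)) ->
  smooth A (fun x => fpow q (f x)).
Proof.
move=> oA sf af; rewrite /fpow; have [//|q1] := eqVneq q 1.
by apply: smooth_powR => // x /af[/eqP|//]; rewrite (negbTE q1).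
Qed.

End Domains.

Section CaputoPartial.
Context {R : realType}.
Variables (n : nat) (q : R).
Hypothesis q01 : 0 < q <= 1.
Local Notation M := 'rV[R]_n.+1.
Local Notation Dbase := (@Dbase R n q).
Implicit Types (g h : M -> R) (i : 'I_n.+1) (x : M).

Lemma subst_coordE (x : M) i s :
  subst_coord x i s = s *: delta_mx 0 i + subst_coord x i 0.
Proof.
apply/rowP => j; rewrite !mxE eqxx /=.
by case: eqVneq => _; rewrite ?mulr1 ?addr0 ?mulr0 ?add0r.
Qed.

Lemma subst_coord_id (x : M) i : subst_coord x i (x 0 i) = x.
Proof. by apply/rowP => j; rewrite !mxE; case: eqVneq => [->|]. Qed.

Lemma derive1_subst_coord g x i s : smooth setT g ->
  derive1 (fun s => g (subst_coord x i s)) s =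
    'D_(delta_mx 0 i) g (subst_coord x i s).
Proof.
move=> sg; rewrite derive1E.
under eq_fun do rewrite subst_coordE.
rewrite [in RHS]subst_coordE.
apply: (@derive_val _ _ _ _ _ _ _ (is_derive_line _)).
exact: smooth_derivable sg _.
Qed.

Lemma Dbase1 i g x : q = 1 -> smooth setT g ->
  Dbase i g x = 'D_(delta_mx 0 i) g x.
Proof.
move=> q1 sg; rewrite /Defs.Dbase /caputo q1 eqxx derive1_subst_coord //.
by rewrite subst_coord_id.
Qed.

Lemma weight_caputo : q != 1 -> weight (caputo_weight q).
Proof.
move=> q1; apply: integrable_caputo_weight.
by have /andP[q0 qle] := q01; rewrite q0 lt_neqAle q1.
Qed.

(** In this form the domain of integration is the same for all [x], which makes
    the derivative accessible to differentiation under the integral sign. *)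
Lemma DbaseE i g x : q != 1 -> smooth setT g -> base_dom q x ->
  Dbase i g x = (Gamma (1 - q))^-1 * (x 0 i `^ (1 - q) *
    shrink_wint (row_coord i) (delta_mx 0 i) (caputo_weight q)
      (fun y => 'D_(delta_mx 0 i) g y) x).
Proof.
move=> q1 sg xd; rewrite /Defs.Dbase.
have t0 : 0 < x 0 i by case: (xd i) => // /eqP; rewrite (negbTE q1).
pose phi s := 'D_(delta_mx 0 i) g (subst_coord x i s).
have shrinkE tau : subst_coord x i (x 0 i * tau) =
    shrink (row_coord i) (delta_mx 0 i) tau x.
  apply/rowP => j; rewrite /shrink /row_coord !mxE eqxx /=.
  rewrite -[row_coord i x]/(x 0 i).
  by case: eqVneq => [->|_] /=; [rewrite mulr1; ring|rewrite mulr0 addr0].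
have cD : continuous (fun y => 'D_(delta_mx 0 i) g y).
  by move=> y; apply: (smooth_continuous (smooth_derive _ sg)).
have phiE : (fun tau => phi (x 0 i * tau)) =
    (fun tau => 'D_(delta_mx 0 i) g (shrink (row_coord i) (delta_mx 0 i) tau x)).
  by apply/funext => tau; rewrite /phi shrinkE.
have cphi : continuous (fun tau => phi (x 0 i * tau)).
  rewrite phiE; exact: (@continuous_comp_shrinkl _ _ _ _ _ x cD).
have mphi : measurable_fun `]0, x 0 i[ phi.
  apply: measurable_funTS; apply: continuous_measurable_fun => s.
  have -> : phi = (fun tau => phi (x 0 i * tau)) \o (fun s => (x 0 i)^-1 * s).
    by apply/funext => a /=; rewrite mulrA mulfV ?mul1r // gt_eqF.
  apply: continuous_comp; last exact: cphi.
  by apply: cvgM; [exact: cvg_cst|exact: cvg_id].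
have dphi s : 0 < s < x 0 i ->
    derive1 (fun s => g (subst_coord x i s)) s = phi s.
  by move=> _; exact: derive1_subst_coord.
rewrite (caputo_scale q1 t0 dphi mphi (weightM (weight_caputo q1) cphi)).
rewrite -/(wint _ (fun tau => phi (x 0 i * tau))) phiE.
by [].
Qed.

Lemma Dbase_lin i a g h x : smooth setT g -> smooth setT h -> base_dom q x ->
  Dbase i (fun y => a * g y + h y) x = a * Dbase i g x + Dbase i h x.
Proof.
move=> sg sh xd.
have sag : smooth setT (fun y => a * g y).
  by apply: smoothM => //; [exact: openT|exact: smooth_cst].
have sl : smooth setT (fun y => a * g y + h y).
  by apply: smoothD => //; exact: openT.
have DE y : 'D_(delta_mx 0 i) (fun y => a * g y + h y) y =
    a * 'D_(delta_mx 0 i) g y + 'D_(delta_mx 0 i) h y.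
  have dg := @smooth_derivable _ _ setT g (delta_mx 0 i) y sg I.
  have dh := @smooth_derivable _ _ setT h (delta_mx 0 i) y sh I.
  have := is_deriveD (is_deriveM (@is_derive_cst R M R a y (delta_mx 0 i))
    (derivableP dg)) (derivableP dh).
  move=> /(@derive_val _ _ _ _ _ _ _) ->.
  by rewrite scaler0 addr0.
have [q1|q1] := eqVneq q 1; first by rewrite !Dbase1.
rewrite !DbaseE // /shrink_wint.
set e := delta_mx 0 i : M.
have c (f : M -> R) : smooth setT f ->
    continuous (fun tau => 'D_e f (shrink (row_coord i) e tau x)).
  move=> sf; apply: (@continuous_comp_shrinkl _ _ _ _ (fun y => 'D_e f y) x).
  by move=> y; apply: smooth_continuous (smooth_derive _ sf) _.
have w := weight_caputo q1.
under [X in wint _ X]eq_fun do rewrite DE.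
rewrite (wintD w _ (c _ sh)); last first.
  by move=> tau; apply: cvgM; [exact: cvg_cst|exact: c].
rewrite (wintZ _ w (c _ sg)).
move: (wint _ _) (wint _ _) (_ `^ _) (_^-1) => A B C D.
ring.
Qed.

Lemma Dbase_cst i a x : Dbase i (fun=> a) x = 0.
Proof. exact: caputo_cst. Qed.

Lemma Dbase_scale i a g x : smooth setT g -> base_dom q x ->
  Dbase i (fun y => a * g y) x = a * Dbase i g x.
Proof.
move=> sg xd; have := @Dbase_lin i a g (fun=> 0) x sg (@smooth_cst _ _ _ _) xd.
rewrite Dbase_cst addr0 => <-; congr (Dbase i _ x).
by apply/funext => y; rewrite addr0.
Qed.

(** These are exactly the cases in which the Leibniz rule of an algebroid is
    required. *)
Lemma DbaseM i g h x : smooth setT g -> smooth setT h -> base_dom q x ->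
  q = 1 \/ (forall y z, h y = h z) ->
  Dbase i (fun y => g y * h y) x = h x * Dbase i g x + g x * Dbase i h x.
Proof.
move=> sg sh xd [q1|hc].
  have sm : smooth setT (fun y => g y * h y).
    by apply: smoothM => //; exact: openT.
  rewrite !Dbase1 //.
  have dg := @smooth_derivable _ _ setT g (delta_mx 0 i) x sg I.
  have dh := @smooth_derivable _ _ setT h (delta_mx 0 i) x sh I.
  by have := deriveM dg dh => ->; rewrite addrC.
have -> : h = (fun=> h x) by apply/funext => y; exact: hc.
rewrite Dbase_cst mulr0 addr0.
under [X in Dbase i X]eq_fun do rewrite mulrC.
exact: Dbase_scale.
Qed.

(** Away from the coordinate hyperplane, [x_i^(1 - q)] is smooth, and so is the
    remaining integral. *)
Lemma smooth_Dbase i g : smooth setT g -> smooth (base_dom q) (Dbase i g).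
Proof.
move=> sg; have oB := @open_base_dom R n q.
have [q1|q1] := eqVneq q 1.
  apply: (smooth_eq_on oB (f := fun x => 'D_(delta_mx 0 i) g x)).
    by move=> x _; rewrite Dbase1.
  by apply: (smooth_subset (@subsetT _ _)); exact: smooth_derive.
apply: (smooth_eq_on oB) => [x xd|]; first by rewrite DbaseE.
apply: smoothM => //; first exact: smooth_cst.
apply: smoothM => //.
  apply: smooth_powR => //; first exact: smooth_coord.
  by move=> x /(_ i)[/eqP|//]; rewrite (negbTE q1).
apply: (smooth_subset (@subsetT _ _)); apply: smooth_shrink_wint.
- exact: coord_continuous.
- exact: weight_caputo.
- exact: smooth_derive.
Qed.

End CaputoPartial.

(** * Algebroids from structure functions and anchors *)

Section Algebroid.
Context {R : realType}.
Variables (n m : nat) (q : R).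
Hypothesis q01 : 0 < q <= 1.
Local Notation M := 'rV[R]_n.+1.
Local Notation F := 'rV[R]_m.+1.
Local Notation Es := ('rV[R]_n.+1 * 'rV[R]_m.+1)%type.
Local Notation dom := (@base_dom R n q).
Let odom : open dom := @open_base_dom R n q.

Section Anchor.
Variable r : M -> 'M[R]_(m.+1, n.+1).
Local Notation anchor := (@left_anchor R n m q r).
Implicit Types (s : M -> F) (f g : M -> R) (x : M).

(** With the matrix transposed, the facts about left anchors also serve for right
    anchors. *)
Lemma right_anchorE (r2 : M -> 'M[R]_(n.+1, m.+1)) s g :
  right_anchor q r2 s g = left_anchor q (fun y => (r2 y)^T) s g.
Proof.
apply/funext => x.
by apply: eq_bigr => u _; apply: eq_bigr => i _; rewrite mxE.
Qed.

Lemma anchor_linl a s1 s2 g x :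
  anchor (fun y => a *: s1 y + s2 y) g x = a * anchor s1 g x + anchor s2 g x.
Proof.
rewrite /left_anchor mulr_sumr -big_split; apply: eq_bigr => u _.
rewrite mulr_sumr -big_split; apply: eq_bigr => i _.
by rewrite /= !mxE; ring.
Qed.

Lemma anchor_scale f s g x :
  anchor (fun y => f y *: s y) g x = f x * anchor s g x.
Proof.
rewrite /left_anchor mulr_sumr; apply: eq_bigr => u _.
rewrite mulr_sumr; apply: eq_bigr => i _.
by rewrite /= !mxE; ring.
Qed.

Lemma anchor_linr a s g h x : smooth setT g -> smooth setT h -> dom x ->
  anchor s (fun y => a * g y + h y) x = a * anchor s g x + anchor s h x.
Proof.
move=> sg sh xd.
rewrite /left_anchor mulr_sumr -big_split; apply: eq_bigr => u _.
rewrite mulr_sumr -big_split; apply: eq_bigr => i _.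
rewrite /= (Dbase_lin q01 i a sg sh xd).
move: (Dbase q i g x) (Dbase q i h x) (s x 0 u) (r x u i) => A B C D.
ring.
Qed.

Lemma anchorM s g h x : smooth setT g -> smooth setT h -> dom x ->
  q = 1 \/ (forall y z, h y = h z) ->
  anchor s (fun y => g y * h y) x = h x * anchor s g x + g x * anchor s h x.
Proof.
move=> sg sh xd qh.
rewrite /left_anchor !mulr_sumr -big_split; apply: eq_bigr => u _.
rewrite !mulr_sumr -big_split; apply: eq_bigr => i _.
rewrite /= (DbaseM q01 i sg sh xd qh).
move: (Dbase q i g x) (Dbase q i h x) (s x 0 u) (r x u i) => A B C D.
ring.
Qed.

Lemma anchor_cst s c x : anchor s (fun=> c) x = 0.
Proof.
rewrite /left_anchor big1 // => u _; rewrite big1 // => i _.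
by rewrite Dbase_cst mulr0.
Qed.

Lemma smooth_anchor s g : (forall u i, smooth dom (fun x => r x u i)) ->
  is_section setT s -> smooth setT g -> smooth dom (anchor s g).
Proof.
move=> sr ss sg; apply: smooth_sum => // u; apply: smooth_sum => // i.
apply: smoothM => //; last exact: smooth_Dbase.
by apply: smoothM => //; apply: (smooth_subset (@subsetT _ _)); exact: ss.
Qed.

End Anchor.

(** The only candidate left by bilinearity and the Leibniz rule: structure
    functions on the basis sections, anchors on the coefficients. *)
Definition leibniz_bracket (C : 'I_m.+1 -> 'I_m.+1 -> M -> F)
    (r1 : M -> 'M[R]_(m.+1, n.+1)) (r2 : M -> 'M[R]_(n.+1, m.+1))
    (s1 s2 : M -> F) (x : M) : F :=
  \row_w (\sum_u \sum_v s1 x 0 u * s2 x 0 v * C u v x 0 w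
          + left_anchor q r1 s1 (fun y => s2 y 0 w) x
          - right_anchor q r2 s2 (fun y => s1 y 0 w) x).

Lemma leibniz_bracketE C r1 r2 s1 s2 x w :
  leibniz_bracket C r1 r2 s1 s2 x 0 w =
    \sum_u \sum_v s1 x 0 u * s2 x 0 v * C u v x 0 w
    + left_anchor q r1 s1 (fun y => s2 y 0 w) x
    - right_anchor q r2 s2 (fun y => s1 y 0 w) x.
Proof. by rewrite mxE. Qed.

(** Bilinearity of [leibniz_bracket] is the linearity of an anchor in each of its
    arguments, and the Leibniz rule, read on one component, is the product rule
    for anchors. *)
Lemma frac_leibniz_algebroid_intro (P : Es -> 'M[R]_m.+1)
    (r1 : M -> 'M[R]_(m.+1, n.+1)) (r2 : M -> 'M[R]_(n.+1, m.+1))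
    (C : 'I_m.+1 -> 'I_m.+1 -> M -> F) (c : M -> 'M[R]_m.+1) :
  (forall u i, smooth dom (fun x => r1 x u i)) ->
  (forall i u, smooth dom (fun x => r2 x i u)) ->
  (forall u v, is_section dom (C u v)) ->
  (forall u v, smooth dom (fun x => c x u v)) ->
  (forall x xi, dom x -> forall u v,
     P (x, xi) u v = \sum_w C u v x 0 w * xi 0 w + c x u v) ->
  frac_leibniz_algebroid q P r1 r2.
Proof.
move=> sr1 sr2 sC sc PE; split => //.
exists C, c, (leibniz_bracket C r1 r2); split => //.
- move=> s1 s2 ss1 ss2 w.
  under eq_fun do rewrite leibniz_bracketE.
  have sT s u : is_section setT s -> smooth dom (fun x => s x 0 u).
    by move=> /(_ u); exact: smooth_subset.
  apply: smoothB => //; first apply: smoothD => //.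
  + apply: smooth_sum => // u; apply: smooth_sum => // v.
    by apply: smoothM => //; [apply: smoothM => //; exact: sT|exact: sC].
  + exact: smooth_anchor.
  + rewrite right_anchorE; apply: smooth_anchor => // u i.
    by apply: smooth_eq_on (sr2 i u) => // x _; rewrite mxE.
- split.
  + move=> a s1 s2 s ss1 ss2 ss x xd; split; apply/rowP => w;
      rewrite [RHS]mxE [X in X + _]mxE [X in X = _]leibniz_bracketE
        [X in a * X]leibniz_bracketE [X in _ = _ + X]leibniz_bracketE.
    * set S := \sum_u \sum_v _; set S1 := \sum_u \sum_v s1 x 0 u * _ * _.
      set S2 := \sum_u \sum_v s2 x 0 u * _ * _.
      have -> : S = a * S1 + S2.
        rewrite /S /S1 /S2 mulr_sumr -big_split; apply: eq_bigr => u _.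
        rewrite mulr_sumr -big_split; apply: eq_bigr => v _.
        by rewrite /= !mxE; ring.
      rewrite anchor_linl !right_anchorE.
      rewrite (_ : (fun y => (a *: s1 y + s2 y) 0 w) =
          fun y => a * s1 y 0 w + s2 y 0 w).
        rewrite anchor_linr //.
        do 4 move: (left_anchor _ _ _ _ _) => ?; clearbody S1 S2; ring.
      by apply/funext => y; rewrite !mxE.
    * set S := \sum_u \sum_v _; set S1 := \sum_u \sum_v _ * s1 x 0 v * _.
      set S2 := \sum_u \sum_v _ * s2 x 0 v * _.
      have -> : S = a * S1 + S2.
        rewrite /S /S1 /S2 mulr_sumr -big_split; apply: eq_bigr => u _.
        rewrite mulr_sumr -big_split; apply: eq_bigr => v _.
        by rewrite /= !mxE; ring.
      rewrite !right_anchorE anchor_linl.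
      rewrite (_ : (fun y => (a *: s1 y + s2 y) 0 w) =
          fun y => a * s1 y 0 w + s2 y 0 w).
        rewrite anchor_linr //.
        do 4 move: (left_anchor _ _ _ _ _) => ?; clearbody S1 S2; ring.
      by apply/funext => y; rewrite !mxE.
  + move=> s1 s2 f g ss1 ss2 sf sg qs x xd; apply/rowP => w; rewrite !mxE.
    set S := \sum_u \sum_v _; set S1 := \sum_u \sum_v s1 x 0 u * _ * _.
    have -> : S = f x * g x * S1.
      rewrite /S /S1 mulr_sumr; apply: eq_bigr => u _.
      rewrite mulr_sumr; apply: eq_bigr => v _.
      by rewrite /= !mxE; ring.
    rewrite !right_anchorE !anchor_scale.
    have EM s h : (fun y => (h y *: s y : F) 0 w) = fun y => h y * s y 0 w.
      by apply/funext => y; rewrite mxE.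
    rewrite !EM.
    have q1 : q = 1 \/ (forall y z, s1 y 0 w = s1 z 0 w).
      by case: qs => [->|[c1 _]]; [left|right => y z; rewrite (c1 y z)].
    have q2 : q = 1 \/ (forall y z, s2 y 0 w = s2 z 0 w).
      by case: qs => [->|[_ c2]]; [left|right => y z; rewrite (c2 y z)].
    rewrite (anchorM _ _ sg (ss2 w) xd q2) (anchorM _ _ sf (ss1 w) xd q1).
    do 4 move: (left_anchor _ _ _ _ _) => ?; clearbody S1.
    move: (f x) (g x) (s1 x 0 w) (s2 x 0 w) => ? ? ? ?; ring.
- move=> u v x xd; apply/rowP => w; rewrite !mxE right_anchorE.
  rewrite /basis_section !anchor_cst subr0 addr0 summxE.
  rewrite (bigD1 u) //= [X in _ + X]big1 ?addr0; last first.
    by move=> u' uu'; rewrite big1 // => v' _; rewrite mxE (negbTE uu') andbF !mul0r.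
  rewrite (bigD1 v) //= [X in _ + X]big1 ?addr0; last first.
    by move=> v' vv'; rewrite !mxE (negbTE vv') andbF mulr0 mul0r.
  rewrite [RHS](bigD1 w) //= [X in _ + X]big1 ?addr0; last first.
    by move=> w' ww'; rewrite !mxE eq_sym (negbTE ww') andbF mulr0.
  by rewrite !mxE !eqxx !mul1r mulr1.
Qed.

End Algebroid.

(** * The vector field of a Hamiltonian *)

Lemma eq_caputo (R : realType) (q t : R) (f g : R -> R) :
  f =1 g -> caputo q f t = caputo q g t.
Proof. by move=> /funext ->. Qed.

Section HamiltonianField.
Context {R : realType}.
Variables (n m : nat) (q : R).
Hypothesis q01 : 0 < q <= 1.
Local Notation M := 'rV[R]_n.+1.
Local Notation F := 'rV[R]_m.+1.
Local Notation Es := ('rV[R]_n.+1 * 'rV[R]_m.+1)%type.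
Implicit Types (p : Es) (X : Es -> M * F).

Lemma Dx_coord1 i j p :
  Dx q j (fun p : Es => p.1 0 i) p = caputo q id (p.1 0 i) *+ (i == j).
Proof.
rewrite /Dx /=; case: (eqVneq i j) => [->|ij].
  by apply: eq_caputo => s; rewrite mxE eqxx.
rewrite -[RHS](caputo_cst q (p.1 0 i) (p.1 0 j)).
by apply: eq_caputo => s; rewrite mxE (negbTE ij).
Qed.

Lemma Dxi_coord2 u v p :
  Dxi q v (fun p : Es => p.2 0 u) p = caputo q id (p.2 0 u) *+ (u == v).
Proof.
rewrite /Dxi /=; case: (eqVneq u v) => [->|uv].
  by apply: eq_caputo => s; rewrite mxE eqxx.
rewrite -[RHS](caputo_cst q (p.2 0 u) (p.2 0 v)).
by apply: eq_caputo => s; rewrite mxE (negbTE uv).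
Qed.

Lemma apply_vf_coord1 X i p :
  apply_vf q X (fun p : Es => p.1 0 i) p = (X p).1 0 i * caputo q id (p.1 0 i).
Proof.
rewrite /apply_vf [X in _ + X]big1 ?addr0; last first.
  by move=> u _; rewrite /Dxi /= caputo_cst mulr0.
rewrite (bigD1 i) //= big1 ?addr0 => [|j ji]; rewrite Dx_coord1 ?eqxx //.
by rewrite eq_sym (negbTE ji) mulr0.
Qed.

Lemma apply_vf_coord2 X u p :
  apply_vf q X (fun p : Es => p.2 0 u) p = (X p).2 0 u * caputo q id (p.2 0 u).
Proof.
rewrite /apply_vf [X in X + _]big1 ?add0r; last first.
  by move=> i _; rewrite /Dx /= caputo_cst mulr0.
rewrite (bigD1 u) //= big1 ?addr0 => [|v vu]; rewrite Dxi_coord2 ?eqxx //.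
by rewrite eq_sym (negbTE vu) mulr0.
Qed.

Section Fixed.
Variables (P : Es -> 'M[R]_m.+1) (r1 : M -> 'M[R]_(m.+1, n.+1))
  (r2 : M -> 'M[R]_(n.+1, m.+1)) (H : Es -> R).

(** The vector [X] with [X . a = Lambda (a, b)] for every covector [a]. *)
Definition sharp (p : Es) (b : M * F) : M * F :=
  (\row_i - \sum_u r2 p.1 i u * b.2 0 u,
   \row_u (\sum_v P p u v * b.2 0 v + \sum_i r1 p.1 u i * b.1 0 i)).

Lemma sharpP p (a b : M * F) :
  \sum_i (sharp p b).1 0 i * a.1 0 i + \sum_u (sharp p b).2 0 u * a.2 0 u =
  Lambda P r1 r2 p a b.
Proof.
rewrite /Lambda addrC; congr (_ + _).
  rewrite -big_split; apply: eq_bigr => u _.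
  rewrite mxE mulrDl !mulr_suml; congr (_ + _).
    by apply: eq_bigr => v _; rewrite mulrAC.
  by apply: eq_bigr => i _; rewrite mulrAC.
rewrite -sumrN; apply: eq_bigr => i _; rewrite mxE mulNr mulr_suml; congr (- _).
by apply: eq_bigr => u _; rewrite mulrAC.
Qed.

Definition ham_field (p : Es) : M * F := sharp p (frac_diff q H p).

Lemma apply_ham_field G p :
  apply_vf q ham_field G p =
    Lambda P r1 r2 p (frac_diff q G p) (frac_diff q H p).
Proof.
rewrite -sharpP /apply_vf /ham_field.
by congr (_ + _); apply: eq_bigr => i _; congr (_ * _); rewrite [RHS]mxE.
Qed.

(** The coordinates are smooth test functions. The Caputo derivative of each one
    vanishes along the other coordinates but not along itself, so it detects a
    single component of the field. *)
Lemma is_X_H_unique X p :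
  is_X_H q P r1 r2 H X -> dual_dom q p -> X p = ham_field p.
Proof.
move=> [_ HX] pd; have [ax axi] := pd.
apply: injective_projections; apply/rowP => i.
- have := HX _ (@smooth_coord1 R n m setT i) p pd.
  rewrite -apply_ham_field !apply_vf_coord1; apply: mulIf.
  exact: caputo_id_neq0 (ax i).
- have := HX _ (@smooth_coord2 R n m setT i) p pd.
  rewrite -apply_ham_field !apply_vf_coord2; apply: mulIf.
  exact: caputo_id_neq0 (axi i).
Qed.

Lemma frac_dyn_systemP (J : set R) (x : R -> M) (xi : R -> F) :
  is_frac_vector_field q ham_field ->
  (forall t, J t -> dual_dom q (x t, xi t)) ->
  frac_dyn_system q P r1 r2 H J x xi <->
  forall t, J t ->
    (forall u,
       is_caputo q (fun s => xi s 0 u) t ((ham_field (x t, xi t)).2 0 u)) /\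
    (forall i,
       is_caputo q (fun s => x s 0 i) t ((ham_field (x t, xi t)).1 0 i)).
Proof.
move=> sX dJ; split => [[X [HX sys]] t Jt|sys].
  by rewrite -(is_X_H_unique HX (dJ t Jt)); exact: sys.
exists ham_field; split => //; split => // G _ p _.
exact: apply_ham_field.
Qed.

End Fixed.
End HamiltonianField.

(** * The data on the product of R^3 with itself *)

Lemma forall_I3 (Q : 'I_3 -> Prop) : (forall i, Q i) <-> Q i1 /\ Q i2 /\ Q i3.
Proof.
split=> [H|[H1 [H2 H3]]]; first by split; [|split].
case=> [[|[|[|k]]] Hk] //.
- by rewrite (_ : Ordinal Hk = i1) //; exact: val_inj.
- by rewrite (_ : Ordinal Hk = i2) //; exact: val_inj.
- by rewrite (_ : Ordinal Hk = i3) //; exact: val_inj.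
Qed.

Lemma sum_I3 (R : realType) (f : 'I_3 -> R) : \sum_i f i = f i1 + f i2 + f i3.
Proof.
rewrite !big_ord_recl big_ord0 addr0 addrA.
by congr (f _ + f _ + f _); exact: val_inj.
Qed.

Lemma smooth_mx3 (R : realType) (V : normedModType R) (A : set V)
    (rows : V -> seq (seq R)) :
  (forall i j : 'I_3, smooth A (fun x => nth 0 (nth [::] (rows x) i) j)) ->
  forall i j, smooth A (fun x => mx3 (rows x) i j).
Proof.
move=> srows i j.
rewrite (_ : (fun x => _) = fun x => nth 0 (nth [::] (rows x) i) j) //.
by apply/funext => x; rewrite mxE.
Qed.

Section Data.
Context {R : realType}.
Variables (k q alpha1 alpha2 alpha3 : R).
Hypotheses (q01 : 0 < q <= 1) (a1 : alpha1 != 0) (a3 : alpha3 != 0).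
Local Notation Es := ('rV[R]_3 * 'rV[R]_3)%type.
Local Notation P := (Ptilde k alpha1 alpha2 alpha3).
Local Notation r1 := (rho1 k alpha1 alpha2 alpha3).
Local Notation r2 := (rho2 q alpha1 alpha3).
Local Notation H := (Ham k q alpha1 alpha2 alpha3).
Local Notation X := (ham_field q P r1 r2 H).
Implicit Types (p : Es).

Let caputo_affine_ext f a b t : (forall s, f s = a * fpow q s + b) -> adm q t ->
  caputo q f t = a * Gamma (1 + q).
Proof. by move=> /funext -> ?; exact: caputo_affine_fpow. Qed.

(** As a function of a single coordinate [s], [H] is [a s^q + b]; the factor
    [Gamma (1 + q)] of its Caputo derivative cancels the one in [H]. *)
Lemma Ham_grad p : dual_dom q p ->
  [/\ Dx q i1 H p = - alpha2 * fpow q (p.2 0 i1),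
      Dx q i2 H p = alpha1 * fpow q (p.2 0 i2) & Dx q i3 H p = 0] /\
  [/\ Dxi q i1 H p = - alpha2 * fpow q (p.1 0 i1),
      Dxi q i2 H p = alpha1 * fpow q (p.1 0 i2) &
      Dxi q i3 H p = k * alpha1 / alpha3].
Proof.
move=> [ax axi].
have G0 : Gamma (1 + q) != 0 :> R by rewrite gt_eqF // GammaS_gt0.
pose g := (Gamma (1 + q))^-1 : R.
pose X i := fpow q (p.1 0 i); pose Y i := fpow q (p.2 0 i).
split; split.
- rewrite /Dx (@caputo_affine_ext _ (g * (- alpha2 * Y i1))
    (g * (alpha1 * X i2 * Y i2 + k * alpha1 / alpha3 * Y i3))) //.
    by rewrite /g mulrAC mulVf ?mul1r.
  by move=> s; rewrite /Ham /= !mxE /= -/g /X /Y; ring.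
- rewrite /Dx (@caputo_affine_ext _ (g * (alpha1 * Y i2))
    (g * (- alpha2 * X i1 * Y i1 + k * alpha1 / alpha3 * Y i3))) //.
    by rewrite /g mulrAC mulVf ?mul1r.
  by move=> s; rewrite /Ham /= !mxE /= -/g /X /Y; ring.
- rewrite /Dx (@caputo_affine_ext _ 0
    (g * (- alpha2 * X i1 * Y i1 + alpha1 * X i2 * Y i2
      + k * alpha1 / alpha3 * Y i3))) ?mul0r //.
  by move=> s; rewrite /Ham /= !mxE /= -/g /X /Y; ring.
- rewrite /Dxi (@caputo_affine_ext _ (g * (- alpha2 * X i1))
    (g * (alpha1 * X i2 * Y i2 + k * alpha1 / alpha3 * Y i3))) //.
    by rewrite /g mulrAC mulVf ?mul1r.
  by move=> s; rewrite /Ham /= !mxE /= -/g /X /Y; ring.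
- rewrite /Dxi (@caputo_affine_ext _ (g * (alpha1 * X i2))
    (g * (- alpha2 * X i1 * Y i1 + k * alpha1 / alpha3 * Y i3))) //.
    by rewrite /g mulrAC mulVf ?mul1r.
  by move=> s; rewrite /Ham /= !mxE /= -/g /X /Y; ring.
- rewrite /Dxi (@caputo_affine_ext _ (g * (k * alpha1 / alpha3))
    (g * (- alpha2 * X i1 * Y i1 + alpha1 * X i2 * Y i2))) //.
    by rewrite /g mulrAC mulVf ?mul1r.
  by move=> s; rewrite /Ham /= !mxE /= -/g /X /Y; ring.
Qed.

(** The gradient of [H] enters through its six values only; stating this for an
    abstract covector [b] leaves an identity of rational functions. *)
Lemma sharp_dataE p (b : 'rV[R]_3 * 'rV[R]_3) :
  let x1 := p.1 0 i1 in let x2 := p.1 0 i2 in let x3 := p.1 0 i3 in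
  let xi1 := p.2 0 i1 in let xi2 := p.2 0 i2 in
  b.1 0 i1 = - alpha2 * fpow q xi1 -> b.1 0 i2 = alpha1 * fpow q xi2 ->
  b.1 0 i3 = 0 ->
  b.2 0 i1 = - alpha2 * fpow q x1 -> b.2 0 i2 = alpha1 * fpow q x2 ->
  b.2 0 i3 = k * alpha1 / alpha3 ->
  let Y := sharp P r1 r2 p b in
  [/\ Y.2 0 i1 = k * alpha1 * (fpow q x2 - x2 * xi2 + fpow q xi2),
      Y.2 0 i2 = k * alpha2 * (fpow q x1 - x1 * xi1 + fpow q xi1) &
      Y.2 0 i3 = alpha2 * alpha3 * (- (fpow q x1 * x2 * xi2)
        + x1 * fpow q x2 * xi1 + x1 * fpow q xi2 - x2 * fpow q xi1)] /\
  [/\ Y.1 0 i1 = alpha1 * fpow q x2 * fpow q x3,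
      Y.1 0 i2 = alpha2 * fpow q x1 * fpow q x3 - k * fpow q x1 &
      Y.1 0 i3 = alpha3 * fpow q x1 * fpow q x2].
Proof.
move=> x1 x2 x3 xi1 xi2 B1 B2 B3 B4 B5 B6 Y; rewrite /Y /sharp /=.
split; split; rewrite mxE !sum_I3 /Ptilde /rho1 /rho2 /mx3 !mxE /=
  ?B1 ?B2 ?B3 ?B4 ?B5 ?B6 -/x1 -/x2 -/x3 -/xi1 -/xi2;
  by field; rewrite ?a1 ?a3.
Qed.

Lemma ham_fieldE p : dual_dom q p ->
  let x1 := p.1 0 i1 in let x2 := p.1 0 i2 in let x3 := p.1 0 i3 in
  let xi1 := p.2 0 i1 in let xi2 := p.2 0 i2 in
  [/\ (X p).2 0 i1 = k * alpha1 * (fpow q x2 - x2 * xi2 + fpow q xi2),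
      (X p).2 0 i2 = k * alpha2 * (fpow q x1 - x1 * xi1 + fpow q xi1) &
      (X p).2 0 i3 = alpha2 * alpha3 * (- (fpow q x1 * x2 * xi2)
        + x1 * fpow q x2 * xi1 + x1 * fpow q xi2 - x2 * fpow q xi1)] /\
  [/\ (X p).1 0 i1 = alpha1 * fpow q x2 * fpow q x3,
      (X p).1 0 i2 = alpha2 * fpow q x1 * fpow q x3 - k * fpow q x1 &
      (X p).1 0 i3 = alpha3 * fpow q x1 * fpow q x2].
Proof.
move=> pd.
have [[H1 H2 H3] [H4 H5 H6]] := Ham_grad pd.
by apply: sharp_dataE; rewrite mxE.
Qed.

Lemma smooth_ham_field : is_frac_vector_field q X.
Proof.
have oD := @open_dual_dom R 2 2 q.
have sx i : smooth (dual_dom q) (fun p : Es => p.1 0 i) by exact: smooth_coord1.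
have sxi i : smooth (dual_dom q) (fun p : Es => p.2 0 i) by exact: smooth_coord2.
have sfx i : smooth (dual_dom q) (fun p : Es => fpow q (p.1 0 i)).
  by apply: smooth_fpow => // p [ax _]; exact: ax.
have sfxi i : smooth (dual_dom q) (fun p : Es => fpow q (p.2 0 i)).
  by apply: smooth_fpow => // p [_ ax]; exact: ax.
have sc c : smooth (dual_dom q) (fun _ : Es => c) by exact: smooth_cst.
have XE := ham_fieldE.
split; apply/forall_I3; split; [|split| |split].
- apply: (smooth_eq_on oD) => [p /XE [_ [E _ _]]|]; first exact/esym/E.
  by do 2 apply: smoothM => //.
- apply: (smooth_eq_on oD) => [p /XE [_ [_ E _]]|]; first exact/esym/E.
  by apply: smoothB => //; do 2 apply: smoothM => //.
- apply: (smooth_eq_on oD) => [p /XE [_ [_ _ E]]|]; first exact/esym/E.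
  by do 2 apply: smoothM => //.
- apply: (smooth_eq_on oD) => [p /XE [[E _ _] _]|]; first exact/esym/E.
  apply: smoothM => //; apply: smoothD => //; apply: smoothB => //.
  exact: smoothM.
- apply: (smooth_eq_on oD) => [p /XE [[_ E _] _]|]; first exact/esym/E.
  apply: smoothM => //; apply: smoothD => //; apply: smoothB => //.
  exact: smoothM.
- apply: (smooth_eq_on oD) => [p /XE [[_ _ E] _]|]; first exact/esym/E.
  apply: smoothM => //; apply: smoothB; [done| |exact: smoothM].
  apply: smoothD; [done| |exact: smoothM].
  apply: smoothD; [done| |by do 2 apply: smoothM => //].
  by apply: smoothN => //; do 2 apply: smoothM => //.
Qed.

Lemma frac_leibniz_algebroid_data : frac_leibniz_algebroid q P r1 r2.
Proof.
pose dom : set 'rV[R]_3 := base_dom q.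
have oB : open dom := @open_base_dom R 2 q.
have sx i : smooth dom (fun x : 'rV[R]_3 => x 0 i) by exact: smooth_coord.
have sfx i : smooth dom (fun x : 'rV[R]_3 => fpow q (x 0 i)).
  by apply: smooth_fpow.
have sc c : smooth dom (fun _ : 'rV[R]_3 => c) by exact: smooth_cst.
have scx c i : smooth dom (fun x : 'rV[R]_3 => c * x 0 i) by exact: smoothM.
have sP xi u v : smooth dom (fun x => P (x, xi) u v).
  move: u v; apply: smooth_mx3; apply/forall_I3; split; [|split];
    apply/forall_I3; split; try split; rewrite /=;
    by [|exact: smoothM|apply: smoothN => //; exact: smoothM].
(* [P] is affine along the fibres: [c] is its value at [xi = 0], and [C] lists
   its increments along the basis covectors. *)
pose c (x : 'rV[R]_3) := P (x, 0).
pose C (u v : 'I_3) (x : 'rV[R]_3) : 'rV[R]_3 :=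
  \row_w (P (x, delta_mx 0 w) u v - P (x, 0) u v).
apply: (@frac_leibniz_algebroid_intro R 2 2 q q01 P r1 r2 C c).
- apply: smooth_mx3; apply/forall_I3; split; [|split];
    apply/forall_I3; split; try split; rewrite /=;
    by [|exact: smoothN].
- pose N (x : 'rV[R]_3) : 'M[R]_3 :=
    mx3 [:: [:: 0; fpow q (x 0 i3); 0];
            [:: - fpow q (x 0 i3); 0; - (alpha3 / alpha1 * fpow q (x 0 i1))];
            [:: 0; alpha3 / alpha1 * fpow q (x 0 i1); 0]].
  have sN i u : smooth dom (fun x => N x i u).
    move: i u; apply: smooth_mx3; apply/forall_I3; split; [|split];
      apply/forall_I3; split; try split; rewrite /=;
      by [|exact: smoothM|exact: smoothN|apply: smoothN => //; exact: smoothM].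
  move=> i u; apply: (smooth_eq_on oB _ (smoothN oB (sN i u))) => x _.
  by rewrite [RHS]mxE.
- move=> u v w.
  have sB := smoothB oB (sP (delta_mx 0 w) u v) (sP 0 u v).
  apply: (smooth_eq_on oB _ sB) => x _.
  by rewrite [RHS]mxE.
- by move=> u v; exact: sP.
- move=> x xi _; apply/forall_I3; split; [|split];
    apply/forall_I3; split; try split;
    rewrite sum_I3 /C /c /Ptilde /mx3 !mxE /=; ring.
Qed.

End Data.

Theorem proposition3p1 (R : realType) (k q alpha1 alpha2 alpha3 : R)
    (hk : k != 0) (hq : 0 < q <= 1) (halpha : alpha1 * alpha2 * alpha3 != 0) :
  let P := Ptilde k alpha1 alpha2 alpha3 in
  let r1 := rho1 k alpha1 alpha2 alpha3 in
  let r2 := rho2 q alpha1 alpha3 in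
  let H := Ham k q alpha1 alpha2 alpha3 in
  frac_leibniz_algebroid q P r1 r2 /\
  forall (J : set R) (x xi : R -> 'rV[R]_3),
    (forall t, J t -> adm q t /\ dual_dom q (x t, xi t)) ->
    (frac_dyn_system q P r1 r2 H J x xi <->
     forall t, J t ->
       let x1 := x t 0 i1 in let x2 := x t 0 i2 in let x3 := x t 0 i3 in
       let xi1 := xi t 0 i1 in let xi2 := xi t 0 i2 in
       is_caputo q (fun s => xi s 0 i1) t
         (k * alpha1 * (fpow q x2 - x2 * xi2 + fpow q xi2)) /\
       is_caputo q (fun s => xi s 0 i2) t
         (k * alpha2 * (fpow q x1 - x1 * xi1 + fpow q xi1)) /\
       is_caputo q (fun s => xi s 0 i3) t
         (alpha2 * alpha3 * (- (fpow q x1 * x2 * xi2) + x1 * fpow q x2 * xi1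
                             + x1 * fpow q xi2 - x2 * fpow q xi1)) /\
       is_caputo q (fun s => x s 0 i1) t (alpha1 * fpow q x2 * fpow q x3) /\
       is_caputo q (fun s => x s 0 i2) t
         (alpha2 * fpow q x1 * fpow q x3 - k * fpow q x1) /\
       is_caputo q (fun s => x s 0 i3) t (alpha3 * fpow q x1 * fpow q x2)).
Proof.
move=> P r1 r2 H.
have /andP[/andP[a1 _] a3] : (alpha1 != 0) && (alpha2 != 0) && (alpha3 != 0).
  by move: halpha; rewrite !mulf_eq0 !negb_or.
split; first exact: frac_leibniz_algebroid_data.
move=> J x xi dJ.
have XE t (Jt : J t) :=
  ham_fieldE k alpha2 hq a1 a3 (dJ t Jt).2.
have sysP := @frac_dyn_systemP R 2 2 q hq P r1 r2 H J x xi
  (smooth_ham_field k alpha2 hq a1 a3) (fun t Jt => (dJ t Jt).2).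
split=> [/sysP sys t Jt|sys].
  have [[E1 E2 E3] [E4 E5 E6]] := XE t Jt.
  have [/forall_I3 [F1 [F2 F3]] /forall_I3 [G1 [G2 G3]]] := sys t Jt.
  by rewrite /= -E1 -E2 -E3 -E4 -E5 -E6.
apply/sysP => t Jt; have [[E1 E2 E3] [E4 E5 E6]] := XE t Jt.
have [F1 [F2 [F3 [G1 [G2 G3]]]]] := sys t Jt.
by split; apply/forall_I3; rewrite ?E1 ?E2 ?E3 ?E4 ?E5 ?E6.
Qed.
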